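(* Consider the Markov chain model described in the context: $n$ users whose data follow irreducible, aperiodic Markov chains with $r$ states and common edge set $E$, with $d=|E|-r\ge 1$, and whose vectors of free transition probabilities are drawn independently from a continuous density $f_{\mathbf{P}}$ for which there are $\delta_1,\delta_2>0$ with $\delta_1<f_{\mathbf{P}}(\mathbf{p})<\delta_2$ for $\mathbf{p}\in\mathcal{R}_{\mathbf{p}}$ and $f_{\mathbf{P}}(\mathbf{p})=0$ for $\mathbf{p}\notin\mathcal{R}_{\mathbf{p}}$. Suppose that $m=cn^{\frac{2}{|E|-r}+\alpha}$ for some $c>0$ and $\alpha>0$, and that $R_u\sim\mathrm{Uniform}[0,a_n]$ with $a_n=c'n^{-\left(\frac{1}{|E|-r}+\beta\right)}$ for some $c'>0$ and $\beta>\frac{\alpha}{4}$. Then the adversary can successfully identify the data of user $1$ as $n\to\infty$; that is, for every $k\in\mathbb{N}$, $$\inf_{\widetilde{X_1(k)}} P\left(\widetilde{X_1(k)}\ne X_1(k)\right)\longrightarrow 0\quad\text{as } n\to\infty,$$ where the infimum is over all estimators $\widetilde{X_1(k)}$ available to the adversary.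
   Context: Markov chain model. The state space is $\{0,1,\dots,r-1\}$, $r\ge2$, and $E$ is a fixed set of directed edges (loops allowed), the same for all users: $(i,l)\in E$ if and only if the transition probability from $i$ to $l$ is positive. The directed graph is such that chains with this edge set are irreducible and aperiodic. User $u$ is characterized by transition probabilities $p_u(i,l)$, $(i,l)\in E$, with $\sum_l p_u(i,l)=1$ for every state $i$. Hence the transition matrix is determined by $d=|E|-r$ free transition probabilities (for each state, all outgoing edges except one fixed one), collected in a vector $\mathbf{p}_u=(p_u(1),\dots,p_u(d))$. Let $$\mathcal{R}_{\mathbf{p}}=\{(x_1,\dots,x_d)\in(0,1)^d: x_i>0\ (i=1,\dots,d),\ x_1+\cdots+x_d<1\}.$$ (Data) For each $n$, the random vectors $\mathbf{P}_1,\dots,\mathbf{P}_n$ are drawn independently from the density $f_{\mathbf{P}}$ on $\mathbb{R}^d$ and are the vectors of free transition probabilities of the $n$ users. Given them, $(X_u(k))_{k\ge1}$ is a Markov chain with the transition probabilities of user $u$, independent across users. (Obfuscation) Independently of everything else, $R_1,\dots,R_n$ are i.i.d. $\mathrm{Uniform}[0,a_n]$, where $a_n\in(0,1]$ (consider $n$ large enough that $a_n\le 1$). Each $R_u$ is drawn once and kept fixed for all times. Given the $X$'s and $R$'s, independently over $u$ and $k$, $P(Z_u(k)=l\mid X_u(k)=i)=1-R_u$ if $l=i$ and $=\frac{R_u}{r-1}$ if $l\ne i$. Let $\mathbf{Z}_u=(Z_u(1),\dots,Z_u(m))^T$, where $m=m(n)$ is the number of observations per user (rounded to an integer). (Anonymization)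 $\Pi$ is a uniformly random permutation of $\{1,\dots,n\}$, independent of everything else, and $\mathbf{Y}=[\mathbf{Z}_{\Pi^{-1}(1)},\dots,\mathbf{Z}_{\Pi^{-1}(n)}]$ is the $m\times n$ matrix observed by the adversary. (Adversary) The adversary knows $\mathbf{P}_1,\dots,\mathbf{P}_n$ (i.e. all transition probabilities of all users) and $a_n$, but not $\Pi$ nor $R_1,\dots,R_n$; an estimator $\widetilde{X_1(k)}$ is a (measurable) function of $\mathbf{Y}$ and $(\mathbf{P}_1,\dots,\mathbf{P}_n)$ with values in $\{0,\dots,r-1\}$, possibly depending on $n$, $k$, $a_n$. *)

(* Defs.v *)
From HB Require Import structures.
From mathcomp Require Import all_boot all_order all_algebra all_fingroup.
From mathcomp Require Import all_classical all_reals all_analysis.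

Set Implicit Arguments.
Unset Strict Implicit.
Unset Printing Implicit Defensive.

Import Order.TTheory GRing.Theory Num.Theory.
Import numFieldNormedType.Exports.

Local Open Scope classical_set_scope.
Local Open Scope ring_scope.

(* Points of R^n are n.-tuple R with the library's product sigma-algebra; the
   library has Lebesgue measure on R only, so it is extended by products. *)
Section lebesgue_tuple.
Context (R : realType).

Definition cons_pair n (xv : measurableTypeR R * n.-tuple R) : n.+1.-tuple R :=
  [the n.+1.-tuple R of xv.1 :: xv.2].

Fixpoint lebesgue_tuple n : set (n.-tuple R) -> \bar R :=
  match n with
  | 0 => \d_ [tuple]
  | n'.+1 =>
      pushforward (lebesgue_measure \x @lebesgue_tuple n')%E (@cons_pair n')
  end.

Lemma measurable_cons_pair n : measurable_fun [set: _] (@cons_pair n).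
Proof. exact: measurable_cons. Qed.

Section step.
Context n (mu : {sigma_finite_measure set (n.-tuple R) -> \bar R}).

Let nu := (lebesgue_measure \x mu)%E.
Let pf : set (n.+1.-tuple R) -> \bar R := pushforward nu (@cons_pair n).

Let pf0 : pf set0 = 0%E.
Proof. by rewrite /pf /pushforward preimage_set0 /nu measure0. Qed.

Let pf_ge0 A : (0 <= pf A)%E.
Proof. exact: (measure_ge0 nu). Qed.

Let pf_sigma_additive : semi_sigma_additive pf.
Proof.
have mpre A : measurable A -> measurable (@cons_pair n @^-1` A).
  by move=> mA; rewrite -[X in measurable X]setTI; exact: measurable_cons_pair.
move=> F mF tF mUF; rewrite /pf /pushforward preimage_bigcup.
apply: (@measure_semi_sigma_additive _ _ _ nu).
- by move=> i; exact: mpre.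
- apply/trivIsetP => i j _ _ ij; rewrite -preimage_setI.
  by move/trivIsetP : tF => /(_ _ _ _ _ ij) ->//; rewrite preimage_set0.
- by rewrite -preimage_bigcup; exact: mpre.
Qed.

HB.instance Definition _ :=
  isMeasure.Build _ _ _ pf pf0 pf_ge0 pf_sigma_additive.

Let pf_sigma_finite : sigma_finite setT pf.
Proof.
pose tl (t : n.+1.-tuple R) : measurableTypeR R * n.-tuple R := (thead t, [tuple of behead t]).
have mtl : measurable_fun [set: _] tl.
  apply: measurable_fun_pair; [exact: measurable_tnth|exact: measurable_behead].
have consK : cancel (@cons_pair n) tl.
  by move=> [x v]; rewrite /tl /cons_pair /=; congr pair; exact/val_inj.
(* the library's sigma-finite instance of \x is shadowed by a later one *)
have [F TF mF] : sigma_finite setT nu.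
  have /sigma_finiteP[F [TF ndF Foo]] := sigma_finiteT (@lebesgue_measure R).
  have /sigma_finiteP[G [TG ndG Goo]] := sigma_finiteT mu.
  exists (fun n => F n `*` G n).
    rewrite -setXTT TF TG predeqE => -[x y]; split.
      move=> [/= [i _ Fnx] [k _ Gky]]; exists (maxn i k) => //; split.
      - by move: x Fnx; exact/subsetPset/ndF/leq_maxl.
      - by move: y Gky; exact/subsetPset/ndG/leq_maxr.
    by move=> [i _ []/= ? ?]; split; exists i.
  move=> k; have [? ?] := Foo k; have [? ?] := Goo k.
  split; first exact: measurableX.
  by rewrite /nu product_measure1E// lte_mul_pinfty// ge0_fin_numE.
exists (fun i => tl @^-1` F i) => [|i].
  by rewrite -preimage_bigcup -TF preimage_setT.
have [mFi Fi] := mF i.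
split; first by rewrite -[X in measurable X]setTI; exact: mtl.
rewrite /pf /pushforward -comp_preimage (_ : tl \o _ = id) ?preimage_id//.
by apply/funext => x; exact: consK.
Qed.

HB.instance Definition _ := Measure_isSigmaFinite.Build _ _ _ pf pf_sigma_finite.

Lemma lebesgue_tuple_step :
  exists m : {sigma_finite_measure set (n.+1.-tuple R) -> \bar R},
    pushforward (lebesgue_measure \x mu)%E (@cons_pair n) = m.
Proof. by exists pf. Qed.

End step.

Lemma lebesgue_tuple_bundled n :
  exists mu : {sigma_finite_measure set (n.-tuple R) -> \bar R},
    @lebesgue_tuple n = mu.
Proof.
elim: n => [|n [mu muE]]; first by exists (\d_ ([tuple] : 0.-tuple R)).
by rewrite /= muE; exact: lebesgue_tuple_step.
Qed.

Section instances.
Variable n : nat.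
Local Notation mu := (@lebesgue_tuple n).

Let mu0 : mu set0 = 0%E.
Proof. by have [m ->] := lebesgue_tuple_bundled n; rewrite measure0. Qed.

Let mu_ge0 A : (0 <= mu A)%E.
Proof. by have [m ->] := lebesgue_tuple_bundled n; exact: measure_ge0. Qed.

Let mu_sigma_additive : semi_sigma_additive mu.
Proof.
by have [m ->] := lebesgue_tuple_bundled n; exact: measure_semi_sigma_additive.
Qed.

HB.instance Definition _ :=
  isMeasure.Build _ _ _ mu mu0 mu_ge0 mu_sigma_additive.

Let mu_sigma_finite : sigma_finite setT mu.
Proof. by have [m ->] := lebesgue_tuple_bundled n; exact: sigma_finiteT. Qed.

HB.instance Definition _ :=
  Measure_isSigmaFinite.Build _ _ _ mu mu_sigma_finite.

End instances.
End lebesgue_tuple.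

Section graph.
Context (R : realType) (r : nat).

Definition stochastic (Q : 'M[R]_r) :=
  (forall i l, 0 <= Q i l) /\ (forall i, \sum_l Q i l = 1).

Definition irreducible (Q : 'M[R]_r) := forall i l, exists t, 0 < (Q ^+ t) i l.

(* the gcd of {t > 0 | Q^t(i,i) > 0} is 1; a state without return is excluded,
   since then every g is a common divisor *)
Definition aperiodic (Q : 'M[R]_r) := forall i g,
  (forall t, (0 < t)%N -> 0 < (Q ^+ t) i i -> (g %| t)%N) -> g = 1%N.

Definition irreducible_aperiodic_graph (E : {set 'I_r * 'I_r}) :=
  forall Q : 'M[R]_r, stochastic Q ->
    (forall i l, ((i, l) \in E) = (0 < Q i l)) -> irreducible Q /\ aperiodic Q.

(* last i is the end of the one edge out of i whose probability is not free;
   free enumerates all other edges without repetition *)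
Definition free_edges (E : {set 'I_r * 'I_r}) d
    (last : 'I_r -> 'I_r) (free : 'I_d -> 'I_r * 'I_r) :=
  [/\ forall i, (i, last i) \in E, injective free &
      forall e, (exists j, free j = e) <-> (e \in E /\ e.2 <> last e.1)].

(* for l <> last i the sum has one term if (i, l) is an edge, and none
   otherwise *)
Definition transition_matrix d (last : 'I_r -> 'I_r)
    (free : 'I_d -> 'I_r * 'I_r) (p : d.-tuple R) : 'M[R]_r :=
  \matrix_(i, l)
    if l == last i then 1 - \sum_(j | (free j).1 == i) tnth p j
    else \sum_(j | free j == (i, l)) tnth p j.

End graph.

Definition param_region (R : realType) d : set (d.-tuple R) :=
  [set x | (forall j, 0 < tnth x j < 1) /\ \sum_j tnth x j < 1].
Arguments param_region R d : clear implicits.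

(* d.-tuple R has no topology in the library: continuity is that of the
   corresponding function of row vectors *)
Definition tuple_continuous_on (R : realType) d (D : set (d.-tuple R))
    (f : d.-tuple R -> R) :=
  let T (x : 'rV[R]_d) := [tuple x ord0 j | j < d] in
  {within [set x : 'rV[R]_d | D (T x)],
    continuous (fun x : 'rV[R]_d => f (T x))}.

(* q is a version of the conditional probability of C given F *)
Definition is_cond_prob (R : realType) disp (Om : measurableType disp)
    (Pr : probability Om R) (F : set (set Om)) (C : set Om) (q : Om -> R) :=
  (forall B : set R, measurable B -> F (q @^-1` B)) /\
  (forall G, F G -> Pr (G `&` C) = (\int[Pr]_(w in G) (q w)%:E)%E).

(* The random elements of the problem with n users, r states and d free
   transition probabilities. Time starts at 0: data u k is the value at the
   (k+1)-st time, and likewise for report. *)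
Record system (R : realType) (r d n : nat) := System {
  sdisp : measure_display;
  outcome : measurableType sdisp;
  Pr : probability outcome R;
  param : 'I_n -> outcome -> d.-tuple R;
  data : 'I_n -> nat -> outcome -> 'I_r;
  noise : 'I_n -> outcome -> R;
  report : 'I_n -> nat -> outcome -> 'I_r;
  anon : outcome -> {perm 'I_n}
}.
Arguments Pr {R r d n} s.
Arguments param {R r d n} s u w : rename.
Arguments data {R r d n} s u k w : rename.
Arguments noise {R r d n} s u w : rename.
Arguments report {R r d n} s u k w : rename.
Arguments anon {R r d n} s w : rename.

Section model.
Context (R : realType) (r d n : nat) (S : system R r d n).

Definition measurable_system :=
  [/\ forall u, measurable_fun setT (param S u),
      forall u k i, measurable (data S u k @^-1` [set i]),
      forall u, measurable_fun setT (noise S u),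
      forall u k i, measurable (report S u k @^-1` [set i]) &
      forall s, measurable (anon S @^-1` [set s])].

Definition param_events : set (set (outcome S)) :=
  [set A | exists u B, measurable B /\ A = param S u @^-1` B].
Definition data_events : set (set (outcome S)) :=
  [set A | exists u k i, A = data S u k @^-1` [set i]].
Definition noise_events : set (set (outcome S)) :=
  [set A | exists u B, measurable B /\ A = noise S u @^-1` B].
Definition report_events : set (set (outcome S)) :=
  [set A | exists u k i, A = report S u k @^-1` [set i]].

Definition params_iid (f : d.-tuple R -> R) :=
  (forall u (B : set (d.-tuple R)), measurable B ->
     Pr S (param S u @^-1` B) =
     (\int[@lebesgue_tuple R d]_(x in B) (f x)%:E)%E) /\
  (forall B : 'I_n -> set (d.-tuple R), (forall u, measurable (B u)) ->
     Pr S [set w | forall u, B u (param S u w)] =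
     (\prod_u Pr S (param S u @^-1` B u))%E).

(* Given the parameters, the data of the users are independent Markov chains.
   The initial laws nu are unconstrained: they may depend on the user and on
   the parameters. *)
Definition data_markov (Q : d.-tuple R -> 'M[R]_r) :=
  exists nu : 'I_n -> 'I_r -> outcome S -> R,
  [/\ forall u i w, 0 <= nu u i w,
      forall u w, \sum_i nu u i w = 1 &
      forall (M : nat) (x : 'I_n -> nat -> 'I_r),
        is_cond_prob (Pr S) <<s param_events >>
          [set w | forall u k, (k <= M)%N -> data S u k w = x u k]
          (fun w => \prod_u (nu u (x u 0%N) w *
             \prod_(k < M) Q (param S u w) (x u k) (x u k.+1)))].

Definition noise_uniform (a : R) :=
  forall (B : 'I_n -> set R) (G : set (outcome S)),
    (forall u, measurable (B u)) -> <<s param_events `|` data_events >> G ->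
    Pr S (G `&` [set w | forall u, B u (noise S u w)]) =
    (Pr S G *
     \prod_u \int[lebesgue_measure]_(x in B u) (uniform_pdf 0 a x)%:E)%E.

Definition obfuscation (rho : R) (i l : 'I_r) : R :=
  if l == i then 1 - rho else rho / (r%:R - 1).

Definition report_law :=
  forall (M : nat) (z : 'I_n -> nat -> 'I_r),
    is_cond_prob (Pr S) <<s param_events `|` data_events `|` noise_events >>
      [set w | forall u k, (k < M)%N -> report S u k w = z u k]
      (fun w => \prod_u \prod_(k < M)
         obfuscation (noise S u w) (data S u k w) (z u k)).

Definition anon_uniform :=
  forall (s : {perm 'I_n}) (G : set (outcome S)),
    <<s param_events `|` data_events `|` noise_events `|` report_events >> G ->
    Pr S (G `&` anon S @^-1` [set s]) = (Pr S G * (n`!%:R^-1)%:E)%E.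

Definition obfuscated_model (f : d.-tuple R -> R)
    (Q : d.-tuple R -> 'M[R]_r) (a : R) :=
  [/\ measurable_system, params_iid f & data_markov Q] /\
  [/\ noise_uniform a, report_law & anon_uniform].

Definition observation m (w : outcome S) : 'M['I_r]_(m, n) :=
  \matrix_(k < m, v < n) report S ((anon S w)^-1%g v) k w.

Definition param_profile (w : outcome S) : n.-tuple (d.-tuple R) :=
  [tuple param S u w | u < n].

Definition estimator m : set ('M['I_r]_(m, n) -> n.-tuple (d.-tuple R) -> 'I_r) :=
  [set g | forall y i, measurable (g y @^-1` [set i])].

Definition min_error m (u : 'I_n) (k : nat) : \bar R :=
  ereal_inf [set Pr S [set w |
      g (observation m w) (param_profile w) <> data S u k w]
    | g in @estimator m].

End model.

(* Main.v *)
Require Import Defs.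
From HB Require Import structures.
From mathcomp Require Import all_boot all_order all_algebra all_fingroup.
From mathcomp Require Import all_classical all_reals all_analysis.
From mathcomp Require Import measurable_realfun ring lra.
Set Implicit Arguments.
Unset Strict Implicit.
Unset Printing Implicit Defensive.
Import Order.TTheory GRing.Theory Num.Theory.
Import numFieldNormedType.Exports.
Local Open Scope classical_set_scope.
Local Open Scope ring_scope.

(* Column v of the observation is accepted when its transition counts fit the
   chain of user 1: |N(i,l) - p_1(i,l) N(i)| <= m h for all i, l, where
   h = n^-(1/d + alpha/4); the estimator reads X_1(k) off an accepted column.
   The counts N(i,l) - p_u(i,l) N(i) of each user are a martingale with bounded
   increments, so exponential moments bound them by m h / 2 for all n users at
   once, since m h^2 grows like n^(alpha/2). The obfuscation changes about
   m a_n = o(m h) letters per user, because beta > alpha/4. Hence the column of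
   user 1 is accepted. If the column of user u is accepted too, both matrices fit
   the same counts, so |p_u - p_1| = O(h) as soon as every state is visited at
   least of order m times; that lower bound is deterministic, by flow
   conservation along the connected graph, once p_1 is bounded away from the
   boundary of the region. As the density is bounded, some u <> 1 has
   |p_u - p_1| = O(h) with probability O(n h^d) = O(n^(-alpha d / 4)). *)

(** * Transition counts of one path *)

(** With [h = n^-(1/d + x)] one has [n h^d = n^(- x d)] and [m h^2] of order [n^(alpha - 2 x)], so
    [x] has to lie strictly between 0 and [alpha / 2]. The midpoint [x = alpha / 4] is taken, and
    [a_n = o(h)] then reads [beta > alpha / 4]. The separation argument therefore asks only the
    matrix of user 1 to keep away from the boundary, by a [tau] that depends on the target error and
    not on n; the other vectors need only lie in the open region. Conditional laws are given jointly
    for all users, and as versions that behave like probabilities only for vectors in the region and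
    noise in [[0, a]]. Each tail bound is thus proved as a finite sum over paths, uniformly in the
    parameters, the initial law and the noise, and is transferred to the model outside a null event
    by one lemma, [cond_prob_bound]. *)

Section counts.
Context (r : nat).
Implicit Types (x z : nat -> 'I_r) (i l : 'I_r) (M m : nat).

Definition visits M x i : nat := \sum_(k < M) (x k == i).
Definition moves M x i l : nat := \sum_(k < M) ((x k == i) && (x k.+1 == l)).
Definition mismatches m x z : nat := \sum_(k < m) (x k != z k).

Lemma eq_visits M x z i : (forall k, (k <= M)%N -> x k = z k) ->
  visits M x i = visits M z i.
Proof. by move=> xz; apply: eq_bigr => k _; rewrite xz// ltnW. Qed.

Lemma eq_moves M x z i l : (forall k, (k <= M)%N -> x k = z k) ->
  moves M x i l = moves M z i l.
Proof. by move=> xz; apply: eq_bigr => k _; rewrite !xz// ltnW. Qed.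

Lemma eq_mismatches m x x' z z' :
  (forall k, (k < m)%N -> x k = x' k) -> (forall k, (k < m)%N -> z k = z' k) ->
  mismatches m x z = mismatches m x' z'.
Proof. by move=> xx zz; apply: eq_bigr => k _; rewrite xx// zz. Qed.

Lemma sum_visits M x : (\sum_i visits M x i = M)%N.
Proof.
rewrite exchange_big /= -[RHS]card_ord -sum1_card; apply: eq_bigr => k _.
by rewrite (bigD1 (x k))//= eqxx big1 ?addn0// => i /negPf; rewrite eq_sym => ->.
Qed.

(** Arrivals take place at times 1 to [M], while [visits] looks at times 0 to [M - 1]; the successor
    pays for a last arrival at time [M]. *)
Lemma moves_le_visits M x i l : (moves M x i l <= (visits M x l).+1)%N.
Proof.
have le1 : (moves M x i l <= \sum_(k < M) (x k.+1 == l))%N.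
  by apply: leq_sum => k _; case: (x k == i).
have le2 : (\sum_(k < M) (x k.+1 == l) <= visits M.+1 x l)%N.
  by rewrite /visits big_ord_recl /bump/= leq_addl.
apply: leq_trans le1 (leq_trans le2 _).
by rewrite /visits big_ord_recr/= -addn1 leq_add2l leq_b1.
Qed.

Lemma visits_mismatches M x z i :
  (visits M x i <= visits M z i + mismatches M.+1 x z)%N.
Proof.
rewrite /mismatches big_ord_recr/= addnA (leq_trans _ (leq_addr _ _))//.
rewrite -big_split leq_sum//= => k _.
by have [->|] := eqVneq (x k) (z k); case: (_ == i); case: (_ == i).
Qed.

(** One altered letter spoils at most two transitions, the one into it and the one out of it. *)
Lemma moves_mismatches M x z i l :
  (moves M x i l <= moves M z i l + (mismatches M.+1 x z).*2)%N.
Proof.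
have le1 : (\sum_(k < M) (x k != z k) <= mismatches M.+1 x z)%N.
  by rewrite /mismatches big_ord_recr/= leq_addr.
have le2 : (\sum_(k < M) (x k.+1 != z k.+1) <= mismatches M.+1 x z)%N.
  by rewrite /mismatches big_ord_recl/= leq_addl.
rewrite -addnn; apply: leq_trans (leq_add (leqnn _) (leq_add le1 le2)).
rewrite -!big_split leq_sum//= => k _.
have [->|_] := eqVneq (x k) (z k); have [->|_] := eqVneq (x k.+1) (z k.+1);
  by case: (x k == i); case: (z k == i); case: (x k.+1 == l); case: (z k.+1 == l).
Qed.

Lemma mismatchesC m x z : mismatches m x z = mismatches m z x.
Proof. by apply: eq_bigr => k _; rewrite eq_sym. Qed.

End counts.

Section drift.
Context (R : realType) (r : nat).
Implicit Types (Q : 'M[R]_r) (x z : nat -> 'I_r) (i l : 'I_r) (M : nat) (t : R).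

(** This is the sum over [k < M] of [1[x_k = i] (1[x_(k+1) = l] - Q i l)], a martingale in [M] when
    [x] is a chain with matrix [Q]. *)
Definition drift Q M x i l : R :=
  (moves M x i l)%:R - Q i l * (visits M x i)%:R.

Lemma eq_drift Q M x z i l : (forall k, (k <= M)%N -> x k = z k) ->
  drift Q M x i l = drift Q M z i l.
Proof. by move=> xz; rewrite /drift (eq_moves _ _ xz) (eq_visits _ xz). Qed.

(** The constant 3 is 2 for the moves plus 1 for the visits, whose coefficient [Q i l] is at most
    1. *)
Lemma drift_mismatches Q M x z i l : 0 <= Q i l <= 1 ->
  `|drift Q M z i l| <= `|drift Q M x i l| + 3 * (mismatches M.+1 x z)%:R.
Proof.
move=> /andP[Q0 Q1]; rewrite -lerBlDl; apply: le_trans (lerB_dist _ _) _.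
have : (moves M x i l)%:R <= (moves M z i l)%:R + 2 * (mismatches M.+1 x z)%:R :> R.
  by rewrite -natrM -natrD ler_nat mul2n moves_mismatches.
have : (moves M z i l)%:R <= (moves M x i l)%:R + 2 * (mismatches M.+1 x z)%:R :> R.
  by rewrite -natrM -natrD ler_nat mul2n mismatchesC moves_mismatches.
have : (visits M x i)%:R <= (visits M z i)%:R + (mismatches M.+1 x z)%:R :> R.
  by rewrite -natrD ler_nat visits_mismatches.
have : (visits M z i)%:R <= (visits M x i)%:R + (mismatches M.+1 x z)%:R :> R.
  by rewrite -natrD ler_nat mismatchesC visits_mismatches.
rewrite /drift; set vx := (visits M x i)%:R; set vz := (visits M z i)%:R.
set c := (mismatches _ _ _)%:R => h1 h2 h3 h4.
have c0 : 0 <= c by [].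
by rewrite ler_norml; apply/andP; split; nra.
Qed.

Lemma visits_path Q (e : rel 'I_r) M x t tau i p :
  0 <= tau <= 1 -> 0 <= t -> (forall i l, e i l -> tau <= Q i l) ->
  (forall i l, `|drift Q M x i l| <= t) -> path e i p ->
  tau ^+ size p * (visits M x i)%:R - (size p)%:R * (t + 1)
    <= (visits M x (last i p))%:R.
Proof.
move=> /andP[tau0 tau1] t0 eQ dt; elim: p i => [|l p IH] i /=.
  by rewrite mul1r mul0r subr0.
move=> /andP[eil /IH]; apply: le_trans.
have : (moves M x i l)%:R <= (visits M x l)%:R + 1 :> R.
  by rewrite natr1 ler_nat moves_le_visits.
have := dt i l; rewrite /drift ler_norml => /andP[dl _] mv.
have := ler_wpM2r (ler0n R (visits M x i)) (eQ _ _ eil) => tQ.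
have : tau * (visits M x i)%:R - (t + 1) <= (visits M x l)%:R by lra.
move=> /(ler_wpM2l (exprn_ge0 (size p) tau0)) h.
have : tau ^+ size p <= 1 by rewrite exprn_ile1.
move=> /(ler_wpM2r (addr_ge0 t0 ler01)); rewrite mul1r => h'.
by rewrite -natr1 exprSr; lra.
Qed.

(* Flow conservation replaces ergodicity: some state is visited M / r times, and
   if all drifts are small a visited state passes a fraction tau of its visits
   on to each of its successors. *)
Lemma visits_ge Q (e : rel 'I_r) M x t tau i : (0 < r)%N ->
  0 <= tau <= 1 -> 0 <= t -> (forall i l, connect e i l) ->
  (forall i l, e i l -> tau <= Q i l) ->
  (forall i l, `|drift Q M x i l| <= t) ->
  tau ^+ r / r%:R * M%:R - r%:R * (t + 1) <= (visits M x i)%:R.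
Proof.
move=> r0 tau01 t0 ce eQ dt; have /andP[tau0 tau1] := tau01.
(* Pigeonhole on [sum_visits], multiplied out by [r] to avoid division in nat. *)
have [i0 Mi0] : exists i0, (M <= r * visits M x i0)%N.
  apply: contrapT => /forallNP h.
  have: (\sum_i r * visits M x i < \sum_(i < r) M)%N.
    rewrite ltn_neqAle leq_sum ?andbT => [|j _].
      2: by rewrite leqNgt; apply/negP => /ltnW/h.
    apply/eqP => eqs.
    have : (\sum_i (r * visits M x i + 1) <= \sum_(i < r) M)%N.
      by apply: leq_sum => j _; rewrite addn1 ltnNge; apply/negP => /h.
    by rewrite big_split/= sum1_card card_ord eqs -[leqRHS]addn0 leq_add2l leqNgt r0.
  by rewrite -big_distrr/= sum_visits sum_nat_const card_ord ltnn.
have /connectP[p0 ep0 ->] := ce i0 i.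
(* A path without repeated states has at most [r] edges, which bounds the exponent of [tau]
   uniformly. *)
case/shortenP: ep0 => p ep /card_uniqP up _.
have sp : (size p <= r)%N.
  by have := max_card (mem (i0 :: p)); rewrite up card_ord => /ltnW.
apply: le_trans (visits_path tau01 t0 eQ dt ep).
have M1 : M%:R / r%:R <= (visits M x i0)%:R :> R.
  by rewrite ler_pdivrMr ?ltr0n// -natrM ler_nat mulnC.
have h1 : tau ^+ r / r%:R * M%:R <= tau ^+ size p * (visits M x i0)%:R.
  rewrite -mulrA [_^-1 * _]mulrC; apply: ler_pM => //.
  - by rewrite exprn_ge0.
  - by apply: ler_wiXn2l.
have h2 : (size p)%:R * (t + 1) <= r%:R * (t + 1).
  by rewrite ler_wpM2r ?ler_nat// addr_ge0.
lra.
Qed.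

(** Both drifts subtract from the same number of moves, which cancels in their difference. *)
Lemma drift_separates Q Q' M x i l t :
  `|drift Q M x i l| <= t -> `|drift Q' M x i l| <= t ->
  `|Q' i l - Q i l| * (visits M x i)%:R <= 2 * t.
Proof.
move=> d d'; rewrite -[X in _ * X <= _]normr_nat -normrM.
have -> : (Q' i l - Q i l) * (visits M x i)%:R = drift Q M x i l - drift Q' M x i l.
  by rewrite /drift; ring.
by apply: le_trans (ler_normB _ _) _; lra.
Qed.

End drift.

(** * Exponential moments over paths *)

Section path_sums.
Context (R : realType).

Lemma big_tuple_cons (T : finType) n (F : n.+1.-tuple T -> R) :
  \sum_x F x = \sum_a \sum_(t : n.-tuple T) F [tuple of a :: t].
Proof.
rewrite pair_big/= (reindex (fun p : T * n.-tuple T => [tuple of p.1 :: p.2]))//=.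
exists (fun x => (thead x, [tuple of behead x])) => [[a t] _|x _].
  by congr pair; exact: val_inj.
by rewrite /= [in RHS](tuple_eta x).
Qed.

Lemma sum_tuple_prod (T : finType) (i0 : T) n (F : nat -> T -> R) :
  \sum_(x : n.-tuple T) \prod_(k < n) F k (nth i0 x k) =
  \prod_(k < n) \sum_l F k l.
Proof.
elim: n F => [|n IH] F.
  rewrite big_ord0 (big_pred1 [tuple]) ?big_ord0// => x.
  by rewrite [x]tuple0; apply/esym/eqP/val_inj.
rewrite big_tuple_cons big_ord_recl mulr_suml; apply: eq_bigr => a _.
rewrite -(IH (fun k => F k.+1)) mulr_sumr; apply: eq_bigr => t _.
by rewrite big_ord_recl.
Qed.

Context (r : nat) (i0 : 'I_r).

(** Neither [nu] nor [g] is normalised, so that the same expression covers the law of a chain and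
    its exponentially tilted version. *)
Definition path_weight M (nu : 'I_r -> R) (g : 'I_r -> 'I_r -> R)
    (x : nat -> 'I_r) : R :=
  nu (x 0%N) * \prod_(k < M) g (x k) (x k.+1).

Lemma path_weight_ge0 M nu g x : (forall i, 0 <= nu i) ->
  (forall i l, 0 <= g i l) -> 0 <= path_weight M nu g x.
Proof. by move=> nu0 g0; rewrite mulr_ge0// prodr_ge0. Qed.

(** Summing out the first letter pushes the initial law one step forward; inductions on [M]
    therefore keep [nu] general. *)
Lemma sum_path_weightS M nu g :
  \sum_(x : M.+2.-tuple 'I_r) path_weight M.+1 nu g (nth i0 x) =
  \sum_(x : M.+1.-tuple 'I_r)
    path_weight M (fun l => \sum_i nu i * g i l) g (nth i0 x).
Proof.
rewrite big_tuple_cons exchange_big/=; apply: eq_bigr => t _.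
rewrite /path_weight mulr_suml; apply: eq_bigr => a _.
by rewrite big_ord_recl/= mulrA.
Qed.

Lemma sum_path_weight0 nu g :
  \sum_(x : 1.-tuple 'I_r) path_weight 0 nu g (nth i0 x) = \sum_i nu i.
Proof.
rewrite big_tuple_cons; apply: eq_bigr => a _.
rewrite (big_pred1 [tuple]) => [|x]; last by rewrite [x]tuple0; apply/esym/eqP/val_inj.
by rewrite /path_weight big_ord0 mulr1.
Qed.

Lemma sum_path_weight M nu g : (forall i, \sum_l g i l = 1) ->
  \sum_(x : M.+1.-tuple 'I_r) path_weight M nu g (nth i0 x) = \sum_i nu i.
Proof.
move=> g1; elim: M nu => [|M IH] nu; first exact: sum_path_weight0.
rewrite sum_path_weightS IH exchange_big/=; apply: eq_bigr => i _.
by rewrite -mulr_sumr g1 mulr1.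
Qed.

Lemma sum_path_weight_le M nu g b : (forall i, 0 <= nu i) ->
  (forall i l, 0 <= g i l) -> 0 <= b -> (forall i, \sum_l g i l <= b) ->
  \sum_(x : M.+1.-tuple 'I_r) path_weight M nu g (nth i0 x)
    <= (\sum_i nu i) * b ^+ M.
Proof.
move=> nu0 g0 b0 gb; elim: M nu nu0 => [|M IH] nu nu0.
  by rewrite sum_path_weight0 mulr1.
rewrite sum_path_weightS; apply: le_trans (IH _ _) _ => [l|].
  by apply: sumr_ge0 => i _; rewrite mulr_ge0.
rewrite exprS mulrA ler_wpM2r ?exprn_ge0// exchange_big/= mulr_suml.
by apply: ler_sum => i _; rewrite -mulr_sumr ler_wpM2l.
Qed.

End path_sums.

Section exponential_bounds.
Context (R : realType).
Implicit Types (x y lam : R).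

(** From [exp(-x) >= 1 - x] one gets [exp x <= 1 / (1 - x)], and [(1 + x + 2 x^2)(1 - x) = 1 + x^2
    (1 - 2 x)]. *)
Lemma expR_le_quadratic x : x <= 1 / 2 -> expR x <= 1 + x + 2 * x ^+ 2.
Proof.
move=> x2; have x1 : 0 < 1 - x by lra.
have h : expR x <= (1 - x)^-1.
  rewrite -[expR x]invrK -expRN lef_pV2 ?posrE ?expR_gt0//.
  exact: expR_ge1Dx.
apply: le_trans h _; rewrite -[leLHS]mul1r ler_pdivrMr//.
have : 0 <= x ^+ 2 * (1 - 2 * x) by rewrite mulr_ge0 ?sqr_ge0//; lra.
by rewrite !expr2; nra.
Qed.

Context (r : nat) (Q : 'M[R]_r).
Hypothesis stQ : stochastic Q.

Definition tilt lam (i l i' l' : 'I_r) : R :=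
  expR (lam * (((i' == i) && (l' == l))%:R - Q i l * (i' == i)%:R)).

Lemma expR_drift lam M (x : nat -> 'I_r) i l :
  expR (lam * drift Q M x i l) = \prod_(k < M) tilt lam i l (x k) (x k.+1).
Proof.
rewrite -expR_sum -mulr_sumr sumrB -mulr_sumr.
by rewrite /drift /moves /visits !natr_sum.
Qed.

Lemma stochastic_le1 i l : 0 <= Q i l <= 1.
Proof.
have [Q0 Q1] := stQ; rewrite Q0/= -(Q1 i) (bigD1 l)//= lerDl.
by apply: sumr_ge0.
Qed.

(** Rows other than [i] are not tilted. In row [i] the first-order term vanishes because the
    increment of the drift has mean zero, and the increment is at most 1 in absolute value, which
    leaves [1 + 2 lam^2]. *)
Lemma sum_tilt_le lam i l i' : `|lam| <= 1 / 2 ->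
  \sum_l' Q i' l' * tilt lam i l i' l' <= expR (2 * lam ^+ 2).
Proof.
move=> lam2; have [Q0 Q1] := stQ; rewrite /tilt.
have [->{i'}|ii'] := eqVneq i' i; last first.
  under eq_bigr do rewrite andFb mulr0 subr0 mulr0 expR0 mulr1.
  by rewrite Q1 -expR0 ler_expR mulr_ge0// sqr_ge0.
apply: le_trans (expR_ge1Dx _).
have /andP[p0 p1] := stochastic_le1 i l.
set p := Q i l in p0 p1 *.
have le l' : Q i l' * expR (lam * ((true && (l' == l))%:R - p * 1)) <=
    Q i l' * (1 + lam * ((l' == l)%:R - p) + 2 * lam ^+ 2).
  apply: ler_wpM2l => //; rewrite /= mulr1.
  have up : `|(l' == l)%:R - p| <= 1.
    by case: (l' == l); rewrite ler_norml; apply/andP; split; rewrite ?mulr1n ?mulr0n; lra.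
  apply: le_trans (expR_le_quadratic _) _.
    apply: le_trans (ler_norm _) _; rewrite normrM.
    by rewrite -[leRHS]mulr1 ler_pM.
  rewrite lerD2l ler_wpM2l// exprMn -[leRHS]mulr1 ler_wpM2l ?sqr_ge0//.
  by rewrite -real_normK ?num_real// expr_le1.
apply: le_trans (ler_sum _ (fun l' _ => le l')) _.
under eq_bigr do rewrite 2!mulrDr mulr1 mulrBr mulrBr.
rewrite !big_split/= -mulr_suml Q1 mul1r sumrN -mulr_suml Q1 mul1r.
rewrite (bigD1 l)//= eqxx mulr1 big1 => [|l' /negPf->]; last by rewrite mulr0 mulr0.
by rewrite addr0 -/p [p * lam]mulrC subrr addr0.
Qed.

(** Chernoff bound: where [|D| > t], the sum of [exp(lam D)] and [exp(- lam D)] exceeds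
    [exp(lam t)]. The two signs account for the factor 2, and each tilted sum grows by at most
    [exp(2 lam^2)] per step. *)
Lemma drift_tail lam M (i0 : 'I_r) (nu : 'I_r -> R) i l (t : R) :
  0 <= lam <= 1 / 2 -> (forall i, 0 <= nu i) -> \sum_i nu i = 1 ->
  \sum_(x : M.+1.-tuple 'I_r | t < `|drift Q M (nth i0 x) i l|)
     path_weight M nu Q (nth i0 x)
  <= 2 * expR (2 * lam ^+ 2 * M%:R - lam * t).
Proof.
move=> /andP[lam0 lam2] nu0 nu1; have [Q0 Q1] := stQ.
have main lam' : `|lam'| <= 1 / 2 ->
    \sum_(x : M.+1.-tuple 'I_r)
      path_weight M nu Q (nth i0 x) * expR (lam' * drift Q M (nth i0 x) i l)
    <= expR (2 * lam' ^+ 2 * M%:R).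
  move=> l2.
  have -> : \sum_(x : M.+1.-tuple 'I_r)
      path_weight M nu Q (nth i0 x) * expR (lam' * drift Q M (nth i0 x) i l) =
    \sum_(x : M.+1.-tuple 'I_r)
      path_weight M nu (fun i' l' => Q i' l' * tilt lam' i l i' l') (nth i0 x).
    apply: eq_bigr => x _; rewrite expR_drift /path_weight -mulrA; congr *%R.
    by rewrite big_split.
  apply: le_trans (sum_path_weight_le (b := expR (2 * lam' ^+ 2)) _ _ _ _ _ _) _.
  - exact: nu0.
  - by move=> ? ?; rewrite mulr_ge0// expR_ge0.
  - exact: expR_ge0.
  - by move=> i'; exact: sum_tilt_le.
  - by rewrite nu1 mul1r -expRM_natr.
rewrite big_mkcond/=.
pose w (x : M.+1.-tuple 'I_r) := path_weight M nu Q (nth i0 x).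
pose D (x : M.+1.-tuple 'I_r) := drift Q M (nth i0 x) i l.
have h (x : M.+1.-tuple 'I_r) : (if t < `|D x| then w x else 0) <=
   (w x * expR (lam * D x) + w x * expR (- lam * D x)) * expR (- (lam * t)).
  have w0 : 0 <= w x by exact: path_weight_ge0.
  case: ifP => [tD|_]; last first.
    by apply: mulr_ge0 (expR_ge0 _); apply: addr_ge0; apply: mulr_ge0; rewrite ?expR_ge0.
  rewrite -mulrDr -mulrA -[leLHS]mulr1 ler_wpM2l// mulrDl -!expRD.
  have [D0|D0] := leP 0 (D x).
    rewrite ger0_norm// in tD.
    rewrite (@le_trans _ _ (expR (lam * D x + - (lam * t))))// ?lerDl ?expR_ge0//.
    by rewrite -expR0 ler_expR -mulrBr mulr_ge0// subr_ge0 ltW.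
  rewrite ltr0_norm// in tD.
  rewrite (@le_trans _ _ (expR (- lam * D x + - (lam * t))))// ?lerDr ?expR_ge0//.
  by rewrite -expR0 ler_expR mulNr -mulrN -mulrBr mulr_ge0// subr_ge0 ltW.
apply: le_trans; first by apply: ler_sum => x _; exact: h.
rewrite -mulr_suml big_split/= expRD mulrA ler_wpM2r ?expR_ge0//.
have b1 := main lam; have b2 := main (- lam); rewrite normrN sqrrN in b2.
have lam2' : `|lam| <= 1 / 2 by rewrite ger0_norm.
by rewrite mulr_natl mulr2n; exact: lerD (b1 lam2') (b2 lam2').
Qed.

End exponential_bounds.

(** * Obfuscation noise *)

Lemma sum_ffun_marginal (R : realType) (I T : finType) (u : I) (B : pred T)
    (F : I -> T -> R) : (forall v, \sum_x F v x = 1) ->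
  (* The constraint is moved into the factor of [u], set to 0 outside [B]; the sum of products then
     distributes and each remaining user contributes 1. *)
  \sum_(X : {ffun I -> T} | B (X u)) \prod_v F v (X v) = \sum_(x | B x) F u x.
Proof.
move=> F1; pose F' v x := if (v == u) && ~~ B x then 0 else F v x.
transitivity (\sum_(X : {ffun I -> T}) \prod_v F' v (X v)).
  rewrite big_mkcond/=; apply: eq_bigr => X _; case: ifPn => BX.
    apply: eq_bigr => v _; rewrite /F'; case: eqP => //= ->.
    by rewrite BX.
  by apply/esym; rewrite (bigD1 u)//= /F' eqxx BX mul0r.
rewrite -(bigA_distr_bigA F') (bigD1 u)//= [X in _ * X]big1 ?mulr1.
  by rewrite [RHS]big_mkcond/=; apply: eq_bigr => x _; rewrite /F' eqxx/=; case: (B x).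
by move=> v /negPf vu; rewrite -(F1 v); apply: eq_bigr => x _; rewrite /F' vu.
Qed.

Section obfuscation.
Context (R : realType) (r : nat) (rho : R) (i0 : 'I_r).
Hypotheses (r2 : (2 <= r)%N) (rho01 : 0 <= rho <= 1).

Lemma obfuscation_ge0 (i l : 'I_r) : 0 <= obfuscation rho i l.
Proof.
have /andP[rho0 rho1] := rho01; rewrite /obfuscation; case: ifP => _.
  by rewrite subr_ge0.
by rewrite divr_ge0// subr_ge0 ler1n ltnW.
Qed.

Lemma sum_obfuscation_neq (i : 'I_r) :
  \sum_(l | l != i) obfuscation rho i l = rho.
Proof.
rewrite (eq_bigr (fun=> rho / (r%:R - 1))) => [|l /negPf li]; last first.
  by rewrite /obfuscation li.
rewrite sumr_const.
have -> : #|[pred l | l != i]| = (r - 1)%N.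
  by rewrite (cardC1 i) card_ord subn1.
rewrite -[LHS]mulr_natr (natrB _ (ltnW r2)) divfK// subr_eq0 pnatr_eq1.
by rewrite neq_ltn r2 orbT.
Qed.

Lemma sum_obfuscation (i : 'I_r) : \sum_l obfuscation rho i l = 1.
Proof.
by rewrite (bigD1 i)//= sum_obfuscation_neq /obfuscation eqxx subrK.
Qed.

(** Chernoff bound at exponent 1/2: one letter contributes [1 - rho + rho exp(1/2)], which is at
    most [1 + rho <= exp rho] because [exp(1/2) <= 2]. *)
Lemma mismatch_tail m (x : nat -> 'I_r) (t : R) :
  \sum_(z : m.-tuple 'I_r | t < (mismatches m x (nth i0 z))%:R)
     \prod_(k < m) obfuscation rho (x k) (nth i0 z k)
  <= expR (rho * m%:R - t / 2).
Proof.
have /andP[rho0 rho1] := rho01.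
rewrite big_mkcond/=.
pose P (z : m.-tuple 'I_r) := \prod_(k < m) obfuscation rho (x k) (nth i0 z k).
pose c (z : m.-tuple 'I_r) : R := (mismatches m x (nth i0 z))%:R.
have h (z : m.-tuple 'I_r) : (if t < c z then P z else 0) <=
    P z * expR (c z / 2) * expR (- (t / 2)).
  have P0 : 0 <= P z by apply: prodr_ge0 => k _; exact: obfuscation_ge0.
  case: ifP => [tc|_]; last by rewrite !mulr_ge0 ?expR_ge0.
  rewrite -mulrA -[leLHS]mulr1 ler_wpM2l// -expRD -expR0 ler_expR -mulrBl.
  by rewrite mulr_ge0// subr_ge0 ltW.
apply: le_trans; first by apply: ler_sum => z _; exact: h.
rewrite -mulr_suml expRD ler_wpM2r ?expR_ge0//.
have e2 : expR (1 / 2) <= 2 :> R.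
  have := expR_ge1Dx (- (1 / 2) : R); rewrite expRN => h2.
  rewrite -[expR _]invrK -[leRHS]invrK lef_pV2 ?posrE ?invr_gt0 ?expR_gt0//.
  by apply: le_trans h2; lra.
pose F k l := obfuscation rho (x k) l * expR ((x k != l)%:R / 2).
have -> : \sum_z P z * expR (c z / 2) =
    \sum_(z : m.-tuple 'I_r) \prod_(k < m) F k (nth i0 z k).
  apply: eq_bigr => z _; rewrite big_split/=; congr *%R.
  by rewrite /c /mismatches natr_sum mulr_suml expR_sum.
rewrite sum_tuple_prod.
have -> : expR (rho * m%:R) = \prod_(k < m) expR rho.
  by rewrite big_const_ord iter_mulr_1 expRM_natr.
apply: ler_prod => k _; apply/andP; split.
  by apply: sumr_ge0 => l _; rewrite mulr_ge0 ?expR_ge0 ?obfuscation_ge0.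
rewrite (bigD1 (x k))//= /F eqxx mul0r expR0 mulr1.
have -> : \sum_(i < r | i != x k)
    obfuscation rho (x k) i * expR ((x k != i)%:R / 2) = rho * expR (1 / 2).
  rewrite -[in RHS](sum_obfuscation_neq (x k)) mulr_suml; apply: eq_bigr => l lx.
  by rewrite [x k == l]eq_sym lx.
rewrite /obfuscation eqxx; apply: le_trans (expR_ge1Dx _).
by have := ler_wpM2l rho0 e2; lra.
Qed.

Lemma flip_prob m (x : nat -> 'I_r) k : (k < m)%N ->
  \sum_(z : m.-tuple 'I_r | nth i0 z k != x k)
     \prod_(k < m) obfuscation rho (x k) (nth i0 z k) = rho.
Proof.
move=> km; pose F j l :=
  if (j == k) && (l == x k) then 0 else obfuscation rho (x j) l.
transitivity (\sum_(z : m.-tuple 'I_r) \prod_(j < m) F j (nth i0 z j)).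
  rewrite big_mkcond/=; apply: eq_bigr => z _; case: ifPn => [zk|/negPn/eqP zk].
    apply: eq_bigr => j _; rewrite /F; case: eqP => //= ->.
    by rewrite (negPf zk).
  by apply/esym; rewrite (bigD1 (Ordinal km))//= /F eqxx zk eqxx mul0r.
rewrite sum_tuple_prod (bigD1 (Ordinal km))//= [X in _ * X]big1 => [|j].
  rewrite mulr1 -[RHS](sum_obfuscation_neq (x k)) [RHS]big_mkcond/=.
  by apply: eq_bigr => l _; rewrite /F eqxx/=; case: (l == x k).
rewrite -val_eqE/= => /negPf jk; rewrite -[RHS](sum_obfuscation (x j)).
by apply: eq_bigr => l _; rewrite /F jk.
Qed.

End obfuscation.

(** * Conditional probabilities *)

Section conditioning.
Context (R : realType) disp (Om : measurableType disp) (P : probability Om R).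

Lemma measure_bigsetU_le (I : finType) (D : pred I) (A : I -> set Om) :
  (forall i, measurable (A i)) ->
  (P (\big[setU/set0]_(i | D i) A i) <= \sum_(i | D i) P (A i))%E.
Proof.
move=> mA.
suff : measurable (\big[setU/set0]_(i | D i) A i) /\
  (P (\big[setU/set0]_(i | D i) A i) <= \sum_(i | D i) P (A i))%E by case.
elim/big_rec2 : _ => [|i y B _ [mB le]]; first by rewrite measure0.
split; first exact: measurableU.
by apply: (le_trans (measureU2 P (mA i) mB)); rewrite leeD2l.
Qed.

(* C X says that a random label equals X, and A that the label lies in a random
   set, the event that it contains X being G X. *)
Lemma cond_prob_bound (I : finType) (F : set (set Om)) (Ok : set Om)
    (C G : I -> set Om) (q : I -> Om -> R) (A : set Om) (b : R) :
  F `<=` measurable -> (forall B D, F B -> F D -> F (B `&` D)) ->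
  F Ok -> P (~` Ok) = 0%E ->
  (forall X, measurable (C X)) -> (forall X, F (G X)) ->
  (forall X, is_cond_prob P F (C X) (q X)) ->
  (forall X w, Ok w -> 0 <= q X w) ->
  (forall w, Ok w -> \sum_(X | w \in G X) q X w <= b) -> 0 <= b ->
  measurable A -> (forall w, A w -> exists X, G X w /\ C X w) ->
  (P A <= b%:E)%E.
Proof.
move=> Fm FI FOk POk mC FG cq q0 qb b0 mA AGC.
have mOk := Fm _ FOk.
have mq X : measurable_fun setT (q X).
  by move=> _ B mB; rewrite setTI; apply/Fm; exact: (cq X).1.
have mGOC X : measurable (G X `&` Ok `&` C X).
  by apply: measurableI => //; apply: measurableI => //; exact: Fm.
have mU : measurable (\big[setU/set0]_(X : I) (G X `&` Ok `&` C X)).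
  by apply: bigsetU_measurable.
have mOkC : measurable (~` Ok) by exact: measurableC.
(* The bounds on [q] hold on [Ok] only, so its null complement is split off before conditioning. *)
apply: (@le_trans _ _ (P (~` Ok `|` \big[setU/set0]_(X : I) (G X `&` Ok `&` C X)))).
  apply: le_measure; rewrite ?inE//; first exact: measurableU.
  move=> w /AGC[X [GX CX]]; have [okw|nok] := pselect (Ok w); last by left.
  by right; rewrite -bigcup_seq; exists X => //=; rewrite mem_index_enum.
have le_U : (P (~` Ok `|` \big[setU/set0]_(X : I) (G X `&` Ok `&` C X)) <=
    P (~` Ok) + P (\big[setU/set0]_(X : I) (G X `&` Ok `&` C X)))%E.
  exact: measureU2.
apply: le_trans le_U _; rewrite POk add0e.
apply: (le_trans (measure_bigsetU_le _ mGOC)).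
have PE X : P (G X `&` Ok `&` C X) =
    (\int[P]_(w in Ok) ((EFin \o q X) \_ (G X)) w)%E.
  by rewrite (cq X).2 ?[G X `&` Ok]setIC ?integral_mkcondr//; exact: FI.
pose qG X : Om -> \bar R := (EFin \o q X) \_ (G X).
have mqG X : measurable_fun Ok (qG X).
  apply/measurable_restrict => //; first exact: Fm.
  by apply: measurable_funS (measurableT) _ _ => //; exact/measurable_EFinP.
rewrite (eq_bigr _ (fun X _ => PE X)).
have <- : (\int[P]_(w in Ok) \sum_(X : I) qG X w = \sum_(X : I) \int[P]_(w in Ok) qG X w)%E.
  apply: ge0_integral_sum => // X w Okw.
  by rewrite /qG /patch; case: ifP => // _; rewrite lee_fin q0.
apply: (@le_trans _ _ (\int[P]_(x in Ok) (cst b%:E x))%E).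
  apply: ge0_le_integral => //.
  - move=> w Okw; apply: sume_ge0 => X _.
    by rewrite /qG /patch; case: ifP => // _; rewrite lee_fin q0.
  - by apply: emeasurable_sum.
  - move=> w Okw; rewrite /cst (_ : (\sum_X qG X w)%E = (\sum_(X | w \in G X) q X w)%:E).
      by rewrite lee_fin qb.
    by rewrite -sumEFin [RHS]big_mkcond/=; apply: eq_bigr => X _; rewrite /qG /patch.
rewrite integral_cst//= -[leRHS]mule1 lee_wpmul2l ?lee_fin//.
exact: probability_le1.
Qed.
End conditioning.

(** * Boxes and close parameters *)

Section tuple_measure.
Import HBNNSimple.
Context (R : realType).

Lemma lebesgue_tuple_cons n (A : set (measurableTypeR R)) (B : set (n.-tuple R)) :
  measurable A -> measurable B ->
  @lebesgue_tuple R n.+1 [set t | A (thead t) /\ B [tuple of behead t]] =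
  (@lebesgue_measure R A * @lebesgue_tuple R n B)%E.
Proof.
move=> mA mB /=.
have [mu ->] := lebesgue_tuple_bundled R n.
rewrite /pushforward -product_measure1E//; congr (_ _).
apply/seteqP; split=> -[x v] /=; rewrite theadE;
  have -> : [tuple of behead (cons_pair (x, v))] = v by exact/val_inj.
- by [].
- by [].
Qed.

Definition box n (B : 'I_n -> set R) : set (n.-tuple R) :=
  [set t | forall j, B j (tnth t j)].

Lemma measurable_box n (B : 'I_n -> set R) : (forall j, measurable (B j)) ->
  measurable (box B).
Proof.
move=> mB; rewrite (_ : box B = \bigcap_(j in [set: 'I_n]) ((@tnth _ _ ^~ j) @^-1` B j)).
  apply: fin_bigcap_measurable => // j _; rewrite -[X in measurable X]setTI.
  exact: measurable_tnth.
by apply/seteqP; split=> t tB j; [move=> _|]; exact: tB.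
Qed.

Lemma lebesgue_tuple_box n (B : 'I_n -> set R) : (forall j, measurable (B j)) ->
  @lebesgue_tuple R n (box B) = (\prod_j @lebesgue_measure R (B j))%E.
Proof.
elim: n B => [|n IH] B mB.
  by rewrite big_ord0/= diracE mem_set// => -[].
rewrite big_ord_recl -IH// -lebesgue_tuple_cons//; last exact: measurable_box.
congr (_ _); apply/seteqP; split=> t /=.
  move=> tB; split=> [|j]; first exact: tB.
  by rewrite tnth_behead (_ : inord _ = lift ord0 j)//; apply/val_inj; rewrite /= inordK//= ltnS.
move=> [t0 tB] j; case: (unliftP ord0 j) => [j'|] ->; last exact: t0.
have := tB j'; rewrite tnth_behead (_ : inord _ = lift ord0 j')//.
by apply/val_inj; rewrite /= inordK//= ltnS.
exact: mB.
Qed.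

(** Argued on the integral as a supremum over the simple functions below the integrand, since
    nothing here says that [f] is measurable. *)
Lemma ge0_le_integral_cst d (T : measurableType d) (mu : {measure set T -> \bar R})
    (D : set T) (f : T -> R) (b : R) :
  measurable D -> (forall x, 0 <= f x <= b) ->
  (\int[mu]_(x in D) (f x)%:E <= b%:E * mu D)%E.
Proof.
move=> mD fb; rewrite -integral_cst//.
have b0 (x : T) : 0 <= b by have /andP[/le_trans] := fb x; exact.
rewrite !ge0_integralE//; last 2 first.
- by move=> x _; rewrite lee_fin; exact: b0.
- by move=> x _; rewrite lee_fin; have /andP[] := fb x.
apply: ereal_sup_le => _ [h hf <-]; exists h => // x; apply: le_trans (hf x) _.
by rewrite /patch; case: ifP => // _; rewrite lee_fin; have /andP[] := fb x.
Qed.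

End tuple_measure.

Section closeness.
Context (R : realType) disp (Om : measurableType disp) (P : probability Om R).

Lemma sum_disjoint_le1 (I : finType) (A : I -> set Om) :
  (forall i, measurable (A i)) -> (forall i j w, A i w -> A j w -> i = j) ->
  (\sum_i P (A i) <= 1)%E.
Proof.
move=> mA dA.
suff PU (s : seq I) : uniq s ->
    (\sum_(i <- s) P (A i) = P (\big[setU/set0]_(i <- s) A i))%E.
  rewrite PU ?index_enum_uniq//; apply: probability_le1.
  exact: bigsetU_measurable.
elim: s => [|i s IH]; first by rewrite !big_nil measure0.
move=> /= /andP[is_ us]; rewrite !big_cons IH//.
apply/esym; apply: (measureU P) => //; first exact: bigsetU_measurable.
rewrite -subset0 => w [Aiw]; rewrite -bigcup_seq => -[j /= js Ajw].
by move: is_; rewrite (dA _ _ _ Aiw Ajw) js.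
Qed.

Context (d : nat) (X Y : Om -> d.-tuple R) (b : R).
Hypotheses (mX : measurable_fun setT X) (mY : measurable_fun setT Y).
Hypothesis b0 : 0 <= b.
Hypothesis indepXY : forall A B : set (d.-tuple R), measurable A -> measurable B ->
  P (X @^-1` A `&` Y @^-1` B) = (P (X @^-1` A) * P (Y @^-1` B))%E.
Hypothesis lawX : forall A : set (d.-tuple R), measurable A ->
  (P (X @^-1` A) <= b%:E * @lebesgue_tuple R d A)%E.

Lemma measurable_preimage (Z : Om -> d.-tuple R) A : measurable_fun setT Z ->
  measurable A -> measurable (Z @^-1` A).
Proof. by move=> mZ mA; rewrite -[X in measurable X]setTI; exact: mZ. Qed.

(* If Y lies in a cell of the grid of mesh eps, then X lies in the cube of side
   3 eps around that cell. *)
Lemma indep_close_le (eps : R) (C : set Om) : 0 < eps -> measurable C ->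
  (forall w j, C w -> 0 <= tnth (Y w) j <= 1 /\
     `|tnth (X w) j - tnth (Y w) j| <= eps) ->
  (P C <= (b * (3 * eps) ^+ d)%:E)%E.
Proof.
(* Indices up to [N] reach every coordinate in [[0, 1]], the endpoint 1 included. Half-open cells
   are disjoint, so the probabilities that [Y] lies in them add up to at most 1 and the number of
   cells does not enter the bound. *)
move=> eps0 mC XYC; pose N := Num.truncn (eps^-1).
pose cell (J : {ffun 'I_d -> 'I_N.+1}) := box (fun j =>
  `[(J j)%:R * eps, (J j).+1%:R * eps[%classic).
pose cube (J : {ffun 'I_d -> 'I_N.+1}) := box (fun j =>
  `[(J j)%:R * eps - eps, (J j).+1%:R * eps + eps]%classic).
have mcell J : measurable (cell J) by apply: measurable_box => j.
have mcube J : measurable (cube J) by apply: measurable_box => j.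
have Pcube J : (P (X @^-1` cube J) <= (b * (3 * eps) ^+ d)%:E)%E.
  apply: le_trans (lawX (mcube J)) _; rewrite EFinM lee_wpmul2l ?lee_fin//.
  rewrite lebesgue_tuple_box//.
  rewrite (eq_bigr (fun=> (3 * eps)%:E)) => [|j _].
    by rewrite prodEFin prodr_const card_ord.
  rewrite lebesgue_measure_itv/= lte_fin ifT -?EFinB; last first.
    by rewrite -natr1 mulrDl; lra.
  by congr EFin; rewrite -natr1; ring.
pose A J := X @^-1` cube J `&` Y @^-1` cell J.
have mA J : measurable (A J) by apply: measurableI; exact: measurable_preimage.
apply: (@le_trans _ _ (P (\big[setU/set0]_(J : {ffun 'I_d -> 'I_N.+1}) A J))).
  apply: le_measure; rewrite ?inE//; first exact: bigsetU_measurable.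
  move=> w wC; rewrite -bigcup_seq.
  pose J := [ffun j => inord (Num.truncn (tnth (Y w) j / eps))] : {ffun 'I_d -> 'I_N.+1}.
  have Yj j : (J j)%:R * eps <= tnth (Y w) j < (J j).+1%:R * eps.
    have [/andP[Y0 Y1] _] := XYC w j wC.
    have Yeps0 : 0 <= tnth (Y w) j / eps by rewrite divr_ge0// ltW.
    rewrite ffunE inordK; last first.
      by rewrite ltnS le_truncn// ler_pdivrMr// mulVf ?gt_eqF.
    by rewrite -ler_pdivlMr// -ltr_pdivrMr//; exact: truncn_itv.
  exists J; first by rewrite /= mem_index_enum.
  split=> j /=; have /andP[Y1 Y2] := Yj j; rewrite in_itv/=.
    have [_] := XYC w j wC; rewrite ler_norml => /andP[? ?].
    by apply/andP; split; lra.
  by rewrite Y1 Y2.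
have le_U : (P (\big[setU/set0]_(J : {ffun 'I_d -> 'I_N.+1}) A J) <=
  \sum_(J : {ffun 'I_d -> 'I_N.+1}) P (A J))%E by exact: measure_bigsetU_le.
apply: le_trans le_U _.
apply: (@le_trans _ _ (\sum_(J : {ffun 'I_d -> 'I_N.+1})
    (b * (3 * eps) ^+ d)%:E * P (Y @^-1` cell J))%E).
  by apply: lee_sum => J _; rewrite indepXY// lee_wpmul2r.
rewrite -ge0_sume_distrr// -[leRHS]mule1 lee_wpmul2l//.
  by rewrite lee_fin mulr_ge0// exprn_ge0// mulr_ge0// ltW.
apply: sum_disjoint_le1 => [J|J J' w cJ cJ']; first exact: measurable_preimage.
apply/ffunP => j; apply/val_inj.
have := cJ j; have := cJ' j; rewrite /= !in_itv/=.
rewrite -!ler_pdivlMr// -!ltr_pdivrMr// => h1 h2.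
by rewrite -(truncn_def h1) -(truncn_def h2).
Qed.

End closeness.

(** * Transition matrices of the parameter region *)

Section transition.
Context (R : realType) (r d : nat) (E : {set 'I_r * 'I_r}) (last : 'I_r -> 'I_r)
  (free : 'I_d -> 'I_r * 'I_r).
Hypothesis Efree : free_edges E last free.
Local Notation Q := (@transition_matrix R r d last free).
Implicit Types (p : d.-tuple R) (i l : 'I_r).

Lemma free_last j : (free j).2 != last (free j).1.
Proof. by have [_ _ /(_ (free j))[h _]] := Efree; apply/eqP; apply h; exists j. Qed.

Lemma transition_matrix_free p j : Q p (free j).1 (free j).2 = tnth p j.
Proof.
rewrite mxE (negPf (free_last j)) (big_pred1 j)// => j'.
by rewrite -surjective_pairing; have [_ /inj_eq-> _] := Efree.
Qed.

Lemma sum_transition_matrix p i : \sum_l Q p i l = 1.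
Proof.
rewrite (bigD1 (last i))//= mxE eqxx.
rewrite (partition_big (fun j => (free j).2) (fun l => l != last i))/=.
  rewrite -[RHS](subrK (\sum_(l | l != last i) \sum_(j | free j == (i, l)) tnth p j)).
  congr (_ - _ + _).
  by apply: eq_bigr => l /negPf li; rewrite mxE li.
by move=> j /eqP <-; exact: free_last.
Qed.

(** Each state sums only part of the coordinates, so the bound on the total leaves at least [tau]
    for every [last] edge; all edges then have probability at least [tau]. *)
Definition inner_region (tau : R) : set (d.-tuple R) :=
  [set p | (forall j, tau <= tnth p j) /\ \sum_j tnth p j <= 1 - tau].

Lemma inner_region_sub tau p : 0 < tau -> inner_region tau p -> param_region R d p.
Proof.
move=> tau0 [ptau sp]; split=> [j|]; last by lra.
rewrite (lt_le_trans tau0 (ptau j))/=; apply: (@le_lt_trans _ _ (1 - tau)); last lra.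
apply: le_trans sp; rewrite (bigD1 j)//= lerDl; apply: sumr_ge0 => j' _.
by rewrite ltW// (lt_le_trans tau0).
Qed.

Lemma transition_matrix_ge tau p i l : 0 <= tau -> inner_region tau p ->
  (i, l) \in E -> tau <= Q p i l.
Proof.
move=> tau0 [ptau sp] il; rewrite mxE; case: (eqVneq l (last i)) => [_|li].
  rewrite lerBrDr -lerBrDl; apply: le_trans sp.
  rewrite [leRHS](bigID (fun j => (free j).1 == i))/= lerDl.
  by apply: sumr_ge0 => j _; exact: le_trans (ptau j).
have [_ finj fE] := Efree.
have [j fj] : exists j, free j = (i, l) by apply/fE; split=> //; exact/eqP.
by rewrite (big_pred1 j)// => j'; rewrite -fj (inj_eq finj).
Qed.

Lemma transition_matrix0 p i l : (i, l) \notin E -> Q p i l = 0.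
Proof.
move=> ilE; have [Elast _ fE] := Efree.
rewrite mxE ifF; last by apply/negP => /eqP li; move: ilE; rewrite li Elast.
rewrite big_pred0// => j; apply/negP => /eqP fj.
by have [h _] := fE (i, l); move: ilE; rewrite (h _).1//; exists j.
Qed.

Lemma region_inner p : param_region R d p -> exists2 tau, 0 < tau & inner_region tau p.
Proof.
move=> [p01 sp]; pose tau := \big[Num.min/(1 - \sum_j tnth p j)]_j tnth p j.
exists tau.
  apply/bigmin_gtP; split; first by rewrite subr_gt0.
  by move=> j _; have /andP[] := p01 j.
split=> [j|]; first exact: bigmin_le_cond.
by have := bigmin_le_id (index_enum 'I_d) (1 - \sum_j tnth p j) xpredT (tnth p); rewrite -/tau; lra.
Qed.

Lemma transition_matrix_gt0 p i l : param_region R d p ->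
  ((i, l) \in E) = (0 < Q p i l).
Proof.
move=> /region_inner[tau tau0 ptau]; apply/idP/idP => [il|].
  exact: lt_le_trans (transition_matrix_ge (ltW tau0) ptau il).
by apply: contraTT => /transition_matrix0->; rewrite ltxx.
Qed.

Lemma stochastic_transition_matrix p : param_region R d p -> stochastic (Q p).
Proof.
move=> pr; split=> [i l|]; last exact: sum_transition_matrix.
have [il|/transition_matrix0->//] := boolP ((i, l) \in E).
by rewrite ltW// -transition_matrix_gt0.
Qed.

(** The graph hypothesis speaks of stochastic matrices, and [Q p] is one whose positive entries are
    exactly [E]. A positive entry of its power [t] unrolls into a path of [t] edges. *)
Lemma graph_connected p : irreducible_aperiodic_graph R E -> param_region R d p ->
  forall i l, connect [rel i l | (i, l) \in E] i l.
Proof.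
move=> gE pr i l; have sQ := stochastic_transition_matrix pr.
have [irr _] := gE _ sQ (fun i l => transition_matrix_gt0 i l pr).
have Qt_ge0 t i' l' : 0 <= (Q p ^+ t) i' l'.
  elim: t i' l' => [|t IH] i' l'; first by rewrite expr0 mxE ler0n.
  by rewrite exprS -mulmxE mxE; apply: sumr_ge0 => j _; rewrite mulr_ge0 ?sQ.1.
have [t] := irr i l; elim: t i => [|t IH] i.
  by rewrite expr0 mxE; case: eqP => [->|_]; rewrite ?connect0 ?ltxx.
rewrite exprS -mulmxE mxE => /gt_eqF/eqP/psumr_neq0P[j _|j /andP[_ Qj]].
  by rewrite mulr_ge0 ?sQ.1.
have [Q0 Qt0] : 0 < Q p i j /\ 0 < (Q p ^+ t) j l.
  move/lt0r_neq0: Qj; rewrite mulf_eq0 negb_or => /andP[h1 h2].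
  by split; rewrite lt_def ?h1 ?h2/= ?sQ.1.
apply: (connect_trans _ (IH _ Qt0)); apply: connect1.
by rewrite /= (transition_matrix_gt0 i j pr).
Qed.

Lemma measurable_transition_matrix i l : measurable_fun setT (fun p => Q p i l).
Proof.
have ms (B : pred 'I_d) : measurable_fun setT (fun p : d.-tuple R => \sum_(j | B j) tnth p j).
  rewrite (_ : (fun p => _) = (fun p => \sum_(j <- [seq j <- index_enum 'I_d | B j]) tnth p j)); last first.
    by apply/funext => p; rewrite big_filter.
  by apply: measurable_sum => j; exact: measurable_tnth.
rewrite (_ : (fun p => _) = fun p => if l == last i
    then 1 - \sum_(j | (free j).1 == i) tnth p j
    else \sum_(j | free j == (i, l)) tnth p j); last by apply/funext => p; rewrite mxE.
case: (l == last i); last exact: ms.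
by apply: measurable_funB.
Qed.

Lemma measurable_drift M (x : nat -> 'I_r) i l :
  measurable_fun setT (fun p => drift (Q p) M x i l).
Proof.
apply: measurable_funB => //; apply: measurable_funM => //.
exact: measurable_transition_matrix.
Qed.

Lemma measurable_inner_region tau : measurable (inner_region tau).
Proof.
have -> : inner_region tau = box (fun=> `[tau, +oo[%classic) `&`
    (fun p : d.-tuple R => \sum_j tnth p j) @^-1` `]-oo, 1 - tau]%classic.
  apply/seteqP; split=> p [h1 h2]; split=> [j|].
  - by rewrite /= in_itv/= andbT.
  - by rewrite /= in_itv.
  - by have := h1 j; rewrite /= in_itv/= andbT.
  - by move: h2; rewrite /= in_itv.
apply: measurableI; first by apply: measurable_box => j; exact: measurable_itv.
have ms : measurable_fun setT (fun p : d.-tuple R => \sum_j tnth p j).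
  by apply: measurable_sum => j; exact: measurable_tnth.
by rewrite -[X in measurable X]setTI; apply: ms.
Qed.

(** This exhaustion gives the measurability of the region and, by continuity of measure, the choice
    of [tau]. *)
Lemma bigcup_inner_region :
  \bigcup_n inner_region n.+1%:R^-1 = param_region R d.
Proof.
apply/seteqP; split=> [p [n _]|p /region_inner[tau tau0 [ptau sp]]].
  by apply: inner_region_sub; rewrite invr_gt0.
have ntau : (Num.truncn tau^-1).+1%:R^-1 <= tau.
  rewrite invf_ple ?posrE// ltW//.
  by have /andP[] := truncn_itv (ltW (etrans (invr_gt0 _) tau0)).
exists (Num.truncn tau^-1) => //; split=> [j|]; first exact: le_trans (ptau j).
by apply: le_trans sp _; rewrite lerD2l lerN2.
Qed.

Lemma measurable_param_region : measurable (param_region R d).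
Proof.
by rewrite -bigcup_inner_region; apply: bigcupT_measurable => n; exact: measurable_inner_region.
Qed.

End transition.

(** * Events of the model *)

Lemma sigma_algebra_sub_measurable d (T : measurableType d) (G : set (set T)) :
  G `<=` measurable -> <<s G>> `<=` measurable.
Proof. by apply: smallest_sub; exact: sigma_algebra_measurable. Qed.

Lemma sigma_algebraI d (T : measurableType d) (G : set (set T)) A B :
  <<s G>> A -> <<s G>> B -> <<s G>> (A `&` B).
Proof. exact: (@measurableI _ (g_sigma_algebraType G)). Qed.

Lemma sigma_algebra_fin_bigcup d (T : measurableType d) (G : set (set T))
    (I : finType) (D : set I) (A : I -> set T) :
  (forall i, D i -> <<s G>> (A i)) -> <<s G>> (\bigcup_(i in D) A i).
Proof.
by apply: (@fin_bigcup_measurable _ (g_sigma_algebraType G)).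

Qed.

Lemma sigma_algebra_fin_bigcap d (T : measurableType d) (G : set (set T))
    (I : finType) (A : I -> set T) :
  (forall i, <<s G>> (A i)) -> <<s G>> (\bigcap_(i in [set: I]) A i).
Proof.
move=> GA; apply: (@fin_bigcap_measurable _ (g_sigma_algebraType G)) => //.
by move=> i _; exact: GA.

Qed.

(** The device for events that mix discrete data with real parameters: split along the finitely many
    values of the label [L]. *)
Lemma measurable_by_label d (T : measurableType d) (I : finType) (L : T -> I)
    (A : set T) (B : I -> set T) :
  (forall i, measurable (L @^-1` [set i])) -> (forall i, measurable (B i)) ->
  (forall w, A w <-> B (L w) w) -> measurable A.
Proof.
move=> mL mB AB.
have -> : A = \bigcup_(i in [set: I]) (L @^-1` [set i] `&` B i).
  apply/seteqP; split=> w; first by move=> /AB ?; exists (L w).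
  by move=> [i _ [<- ?]]; exact/AB.
by apply: fin_bigcup_measurable => // i _; exact: measurableI.
Qed.

Lemma prob_forall_ae (R : realType) disp (Om : measurableType disp)
    (P : probability Om R) (I : finType) (A : I -> set Om) :
  (forall i, measurable (A i)) -> (forall i, P (~` A i) = 0%E) ->
  P (~` \bigcap_(i in [set: I]) A i) = 0%E.
Proof.
move=> mA A0; apply/eqP; rewrite eq_le measure_ge0 andbT.
have -> : ~` (\bigcap_(i in [set: I]) A i) = \big[setU/set0]_i ~` A i.
  rewrite setC_bigcap -bigcup_seq; apply/seteqP.
  by split=> w [i _ ?]; exists i => //=; rewrite mem_index_enum.
have le_U : (P (\big[setU/set0]_i ~` A i) <= \sum_i P (~` A i))%E.
  by apply: measure_bigsetU_le => i; exact: measurableC.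
by apply: le_trans le_U _; rewrite big1.
Qed.

Section model_events.
Context (R : realType) (r d n : nat) (S : system R r d n) (i0 : 'I_r).
Hypothesis mS : measurable_system S.

Definition data_path m u (w : outcome S) : m.-tuple 'I_r :=
  [tuple data S u k w | k < m].
Definition report_path m u (w : outcome S) : m.-tuple 'I_r :=
  [tuple report S u k w | k < m].

Lemma nth_data_path m u w k : (k < m)%N -> nth i0 (data_path m u w) k = data S u k w.
Proof. by move=> km; rewrite -[k]/(val (Ordinal km)) -tnth_nth tnth_mktuple. Qed.

Lemma nth_report_path m u w k : (k < m)%N ->
  nth i0 (report_path m u w) k = report S u k w.
Proof. by move=> km; rewrite -[k]/(val (Ordinal km)) -tnth_nth tnth_mktuple. Qed.

Lemma param_events_measurable : <<s @param_events _ _ _ _ S>> `<=` measurable.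
Proof.
have [mp _ _ _ _] := mS; apply: sigma_algebra_sub_measurable => _ [u [B [mB ->]]].
exact: measurable_preimage.
Qed.

Lemma noise_in_events u (B : set R) : measurable B ->
  <<s @param_events _ _ _ _ S `|` @data_events _ _ _ _ S `|` @noise_events _ _ _ _ S>>
    (noise S u @^-1` B).
Proof. by move=> mB; apply: sub_sigma_algebra; right; exists u, B. Qed.

Lemma noise_events_measurable :
  <<s @param_events _ _ _ _ S `|` @data_events _ _ _ _ S `|` @noise_events _ _ _ _ S>>
  `<=` measurable.
Proof.
have [mp md mn _ _] := mS; apply: sigma_algebra_sub_measurable.
move=> A [[[u [B [mB ->]]]|[u [k [i ->]]]]|[u [B [mB ->]]]].
- exact: measurable_preimage.
- exact: md.
- by rewrite -[X in measurable X]setTI; exact: mn.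
Qed.

Lemma path_preimage (x : nat -> 'I_n -> outcome S -> 'I_r) m u t :
  (fun w => [tuple x k u w | k < m]) @^-1` [set t] =
  \bigcap_(k in [set: 'I_m]) x k u @^-1` [set tnth t k].
Proof.
apply/seteqP; split=> w /=; first by move=> <- k _; rewrite tnth_mktuple.
by move=> h; apply: eq_from_tnth => k; rewrite tnth_mktuple h.
Qed.

Lemma data_path_in_events m u t :
  <<s @param_events _ _ _ _ S `|` @data_events _ _ _ _ S `|` @noise_events _ _ _ _ S>>
    (data_path m u @^-1` [set t]).
Proof.
rewrite (path_preimage (fun k u => data S u k)); apply: sigma_algebra_fin_bigcap => k.
by apply: sub_sigma_algebra; left; right; exists u, k, (tnth t k).
Qed.

Lemma measurable_data_path m u t : measurable (data_path m u @^-1` [set t]).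
Proof. exact: noise_events_measurable (data_path_in_events _ _ _). Qed.

Lemma measurable_report_path m u t : measurable (report_path m u @^-1` [set t]).
Proof.
have [_ _ _ mr _] := mS.
rewrite (path_preimage (fun k u => report S u k)).
by apply: fin_bigcap_measurable => // k _; exact: mr.
Qed.

Lemma measurable_param u B : measurable B -> measurable (param S u @^-1` B).
Proof. by have [mp _ _ _ _] := mS; exact: measurable_preimage. Qed.

End model_events.

Section model.
Context (R : realType) (r d n : nat) (S : system R r d n) (i0 : 'I_r).
Context (E : {set 'I_r * 'I_r}) (last : 'I_r -> 'I_r) (free : 'I_d -> 'I_r * 'I_r).
Context (f : d.-tuple R -> R) (a delta2 : R).
Local Notation Q := (@transition_matrix R r d last free).
Hypothesis Efree : free_edges E last free.
Hypothesis r2 : (2 <= r)%N.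
Hypothesis f_out : forall p, ~ param_region R d p -> f p = 0.
Hypothesis f_bound : forall p, 0 <= f p <= delta2.
Hypothesis a01 : 0 < a <= 1.
Hypothesis modS : obfuscated_model S f Q a.

Let mS : measurable_system S. Proof. by have [[]] := modS. Qed.

Lemma param_prob_le (u : 'I_n) B : measurable B ->
  (Pr S (param S u @^-1` B) <= delta2%:E * @lebesgue_tuple R d B)%E.
Proof.
have [[_ [law _] _] _] := modS => mB; rewrite law//.
exact: ge0_le_integral_cst.
Qed.

Lemma param_out_region (u : 'I_n) :
  Pr S (param S u @^-1` ~` param_region R d) = 0%E.
Proof.
have [[_ [law _] _] _] := modS; rewrite law.
  by apply: integral0_eq => p pout; rewrite f_out.
by apply: measurableC; exact: measurable_param_region.
Qed.

Lemma params_in_region :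
  Pr S (~` \bigcap_(u in [set: 'I_n]) param S u @^-1` param_region R d) = 0%E.
Proof.
apply: prob_forall_ae => [u|u]; last exact: param_out_region.
by apply: measurable_param => //; exact: measurable_param_region.
Qed.

(** [drift_tail] is uniform in the initial law and in the matrix, so it survives averaging over the
    parameters. The labels are the paths of all users, because the conditional law is given jointly;
    the users other than [u] sum out to 1. *)
Lemma drift_prob (u : 'I_n) i l (lam t : R) M : 0 <= lam <= 1 / 2 ->
  let A := [set w | t < `|drift (Q (param S u w)) M (fun k => data S u k w) i l|] in
  measurable A /\ (Pr S A <= (2 * expR (2 * lam ^+ 2 * M%:R - lam * t))%:E)%E.
Proof.
move=> lam12 A.
pose B (x : M.+1.-tuple 'I_r) : set (d.-tuple R) :=
  [set p | t < `|drift (Q p) M (nth i0 x) i l|].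
have mB x : measurable (B x).
  have mf : measurable_fun setT (fun p => `|drift (Q p) M (nth i0 x) i l|).
    by apply: measurableT_comp => //; exact: measurable_drift.
  rewrite (_ : B x = (fun p => `|drift (Q p) M (nth i0 x) i l|) @^-1` `]t, +oo[%classic).
    by rewrite -[X in measurable X]setTI; exact: mf.
  by apply/seteqP; split=> p; rewrite /= in_itv/= andbT.
have AB w : A w <-> B (data_path M.+1 u w) (param S u w).
  rewrite /A /B /=; set D := drift _ _ _ _ _; set D' := drift _ _ _ _ _.
  suff -> : D = D' by [].
  by apply: eq_drift => k kM; rewrite nth_data_path.
have mA : measurable A.
  apply: (measurable_by_label (L := data_path M.+1 u)
    (B := fun x => param S u @^-1` B x)) => //.
  - exact: measurable_data_path.
  - by move=> x; exact: measurable_param.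
split=> //.
have [[_ _ [nu [nu0 nu1 cnu]]] _] := modS.
pose Lab := {ffun 'I_n -> M.+1.-tuple 'I_r}.
apply: (@cond_prob_bound _ _ _ (Pr S) Lab <<s @param_events _ _ _ _ S>>
  (\bigcap_(v in [set: 'I_n]) param S v @^-1` param_region R d)
  (fun X : Lab => [set w | forall v k, (k <= M)%N -> data S v k w = nth i0 (X v) k])
  (fun X : Lab => param S u @^-1` B (X u))
  (fun (X : Lab) w => \prod_v (nu v (nth i0 (X v) 0%N) w *
             \prod_(k < M) Q (param S v w) (nth i0 (X v) k) (nth i0 (X v) k.+1)))).
- exact: param_events_measurable.
- by move=> ? ?; exact: sigma_algebraI.
- apply: sigma_algebra_fin_bigcap => v; apply: sub_sigma_algebra.
  by exists v, (param_region R d); split=> //; exact: measurable_param_region.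
- exact: params_in_region.
- move=> X; rewrite (_ : [set w | _] =
      \bigcap_(v in [set: 'I_n]) data_path M.+1 v @^-1` [set X v]).
    by apply: fin_bigcap_measurable => // v _; exact: measurable_data_path.
  apply/seteqP; split=> w h v.
    move=> _ /=; apply: eq_from_tnth => k; rewrite tnth_mktuple (tnth_nth i0) h//.
    by rewrite -ltnS.
  by move=> k kM; rewrite -(h v I)//= nth_data_path.
- by move=> X; apply: sub_sigma_algebra; exists u, (B (X u)).
- by move=> X; exact: (cnu M (fun v => nth i0 (X v))).
- move=> X w Okw; apply: prodr_ge0 => v _; apply: (@path_weight_ge0 _ _ M (nu v ^~ w) (Q (param S v w)) (nth i0 (X v))) => // i' l'.
  by have [] := stochastic_transition_matrix Efree (Okw v I).
- move=> w Okw.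
  pose F v (x : M.+1.-tuple 'I_r) :=
    path_weight M (nu v ^~ w) (Q (param S v w)) (nth i0 x).
  have stQ v := stochastic_transition_matrix Efree (Okw v I).
  rewrite (eq_bigl (fun X : Lab => t < `|drift (Q (param S u w)) M (nth i0 (X u)) i l|)); last first.
    by move=> X; apply/idP/idP; rewrite inE.
  rewrite (sum_ffun_marginal u
    (fun x : M.+1.-tuple 'I_r => t < `|drift (Q (param S u w)) M (nth i0 x) i l|) (F := F)).
    exact: drift_tail.
  by move=> v; rewrite sum_path_weight ?nu1// => i'; case: (stQ v).
- by rewrite mulr_ge0// expR_ge0.
- by [].
- move=> w /AB Bw; exists [ffun v => data_path M.+1 v w].
  split; first by rewrite /= ffunE.
  by move=> v k kM; rewrite ffunE nth_data_path.
Qed.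

Lemma noise_in_range :
  Pr S (~` \bigcap_(u in [set: 'I_n]) noise S u @^-1` `[0, a]%classic) = 0%E.
Proof.
have [_ _ mn _ _] := mS; have [_ [uni _ _]] := modS.
have mitv : measurable (`[0, a]%classic : set R) by exact: measurable_itv.
apply: prob_forall_ae => u; first by rewrite -[X in measurable X]setTI; exact: mn.
(* [noise_uniform] constrains all users at once: the others are left free, and the vanishing
   integral of user [u] kills the product. *)
pose B (v : 'I_n) : set R := if v == u then ~` `[0, a]%classic else setT.
have mB v : measurable (B v).
  by rewrite /B; case: ifP => _ //; exact: measurableC.
have -> : ~` (noise S u @^-1` `[0, a]%classic) =
    setT `&` [set w | forall v, B v (noise S v w)].
  rewrite setTI; apply/seteqP; split=> w /= h.
    by move=> v; rewrite /B; case: eqP => // ->.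
  by have := h u; rewrite /B eqxx.
rewrite uni//; last first.
  by apply: (@measurableT _ (g_sigma_algebraType
    (@param_events _ _ _ _ S `|` @data_events _ _ _ _ S))).
rewrite (bigD1 u)//= [X in (_ * (X * _))%E]integral0_eq ?mul0e ?mule0// => x.
by rewrite /B eqxx /uniform_pdf /= in_itv/= => /negP/negPf ->.
Qed.

(** Common source of the bounds on mismatches and on a single flipped letter: a bound uniform over
    the path and over noise levels up to [a] passes to the model. *)
Lemma report_event (u : 'I_n) m (B : rel (m.-tuple 'I_r)) (b : R) :
  let A := [set w | B (data_path m u w) (report_path m u w)] in
  0 <= b ->
  (forall (rho : R) (x : nat -> 'I_r), 0 <= rho <= 1 -> rho <= a ->
    \sum_(z : m.-tuple 'I_r | B [tuple x k | k < m] z)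
      \prod_(k < m) obfuscation rho (x k) (nth i0 z k) <= b) ->
  measurable A /\ (Pr S A <= b%:E)%E.
Proof.
move=> A b0 Bb; have [_ [_ rep _]] := modS.
have mrep := measurable_report_path mS; have mdata := measurable_data_path mS.
have mA : measurable A.
  apply: (measurable_by_label (L := data_path m u)
    (B := fun x => \bigcup_(z in [set z | B x z]) report_path m u @^-1` [set z])).
  - exact: mdata.
  - by move=> x; apply: fin_bigcup_measurable.
  - move=> w; split=> [Aw|[z /= Bz rz]]; last by rewrite /A /= rz.
    by exists (report_path m u w).
split=> //.
pose Lab := {ffun 'I_n -> m.-tuple 'I_r}.
apply: (@cond_prob_bound _ _ _ (Pr S) Lab
  <<s @param_events _ _ _ _ S `|` @data_events _ _ _ _ S `|` @noise_events _ _ _ _ S>>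
  (\bigcap_(v in [set: 'I_n]) noise S v @^-1` `[0, a]%classic)
  (fun Z : Lab => [set w | forall v k, (k < m)%N -> report S v k w = nth i0 (Z v) k])
  (fun Z : Lab => \bigcup_(x in [set x | B x (Z u)]) data_path m u @^-1` [set x])
  (fun (Z : Lab) w => \prod_v \prod_(k < m)
     obfuscation (noise S v w) (data S v k w) (nth i0 (Z v) k))).
- exact: noise_events_measurable.
- by move=> ? ?; exact: sigma_algebraI.
- by apply: sigma_algebra_fin_bigcap => v; exact: noise_in_events.
- exact: noise_in_range.
- move=> Z; rewrite (_ : [set w | _] =
      \bigcap_(v in [set: 'I_n]) report_path m v @^-1` [set Z v]).
    by apply: fin_bigcap_measurable => // v _; exact: mrep.
  apply/seteqP; split=> w h v.
    move=> _ /=; apply: eq_from_tnth => k; rewrite tnth_mktuple (tnth_nth i0) h//.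
  by move=> k kM; rewrite -(h v I)//= nth_report_path.
- by move=> Z; apply: sigma_algebra_fin_bigcup => x _; exact: data_path_in_events.
- by move=> Z; exact: (rep m (fun v => nth i0 (Z v))).
- move=> Z w Okw; apply: prodr_ge0 => v _; apply: prodr_ge0 => k _.
  have /= := Okw v I; rewrite in_itv/= => /andP[h0 h1].
  by apply: obfuscation_ge0; rewrite // h0 (le_trans h1)//; case/andP: a01.
- move=> w Okw.
  have ok v : 0 <= noise S v w <= 1 /\ noise S v w <= a.
    have /= := Okw v I; rewrite in_itv/= => /andP[h0 h1].
    by rewrite h0 (le_trans h1)//; case/andP: a01.
  rewrite (eq_bigl (fun Z : Lab => B (data_path m u w) (Z u))); last first.
    move=> Z; apply/idP/idP; rewrite inE; first by move=> [x /= Bx dx]; rewrite dx.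
    by move=> Bx; exists (data_path m u w).
  pose F v (z : m.-tuple 'I_r) :=
    \prod_(k < m) obfuscation (noise S v w) (data S v k w) (nth i0 z k).
  rewrite (sum_ffun_marginal u (B (data_path m u w)) (F := F)).
    have [ok1 ok2] := ok u.
    exact: (Bb _ (fun k => data S u k w)).
  move=> v; rewrite /F (sum_tuple_prod i0 m (fun k l =>
    obfuscation (noise S v w) (data S v k w) l)) big1// => k _.
  by apply: sum_obfuscation.
- by [].
- by [].
- move=> w Aw; exists [ffun v => report_path m v w].
  split; first by exists (data_path m u w); rewrite /= ?ffunE.
  by move=> v k kM; rewrite ffunE nth_report_path.
Qed.

Lemma mismatch_prob (u : 'I_n) m (t : R) :
  let A := [set w | t < (mismatches m (fun k => data S u k w)
                          (fun k => report S u k w))%:R] in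
  measurable A /\ (Pr S A <= (expR (a * m%:R - t / 2))%:E)%E.
Proof.
pose B (x z : m.-tuple 'I_r) := t < (mismatches m (nth i0 x) (nth i0 z))%:R.
move=> A; have -> : A = [set w | B (data_path m u w) (report_path m u w)].
  apply/seteqP; split=> w; rewrite /A /B /=;
  by rewrite (@eq_mismatches _ m (nth i0 (data_path m u w)) (fun k => data S u k w)
      (nth i0 (report_path m u w)) (fun k => report S u k w)) => // k km;
    rewrite ?nth_data_path ?nth_report_path.
apply: report_event => [|rho x rho01 rhoa]; first exact: expR_ge0.
rewrite (eq_bigl (fun z : m.-tuple 'I_r => t < (mismatches m x (nth i0 z))%:R)).
  apply: (le_trans (mismatch_tail i0 r2 rho01 m x t)).
  by rewrite ler_expR lerD2r ler_wpM2r.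
move=> z; rewrite /B (@eq_mismatches _ m _ x _ (nth i0 z))// => k km.
by rewrite -[k]/(val (Ordinal km)) -tnth_nth tnth_mktuple.
Qed.

Lemma flip_event (u : 'I_n) k :
  let A := [set w | report S u k w <> data S u k w] in
  measurable A /\ (Pr S A <= a%:E)%E.
Proof.
pose B (x z : k.+1.-tuple 'I_r) := nth i0 z k != nth i0 x k.
move=> A; have -> : A = [set w | B (data_path k.+1 u w) (report_path k.+1 u w)].
  apply/seteqP; split=> w; rewrite /A /B /= nth_data_path// nth_report_path//.
    by move/eqP.
  by move/eqP.
apply: report_event => [|rho x rho01 rhoa]; first by case/andP: a01 => /ltW.
rewrite (eq_bigl (fun z : k.+1.-tuple 'I_r => nth i0 z k != x k)).
  by rewrite flip_prob.
move=> z; rewrite /B; congr (_ != _).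
by rewrite (nth_mktuple x i0 (@ord_max k)).
Qed.

Lemma params_close_le (u v : 'I_n) (eps : R) : u != v -> 0 < eps ->
  let A := [set w | param_region R d (param S v w) /\
     forall j, `|tnth (param S u w) j - tnth (param S v w) j| <= eps] in
  measurable A /\ (Pr S A <= (delta2 * (3 * eps) ^+ d)%:E)%E.
Proof.
move=> uv eps0 A; have [[_ [law indep] _] _] := modS.
have [mp _ _ _ _] := mS.
have mA : measurable A.
  have -> : A = param S v @^-1` param_region R d `&`
      \bigcap_(j in [set: 'I_d]) (fun w => tnth (param S u w) j -
        tnth (param S v w) j) @^-1` `[- eps, eps]%classic.
    apply/seteqP; split=> w [rv h]; split=> // j; first by move=> _; rewrite /= in_itv/= -ler_norml.
    by have := h j I; rewrite /= in_itv/= -ler_norml.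
  apply: measurableI.
    by apply: measurable_param => //; exact: measurable_param_region.
  apply: fin_bigcap_measurable => // j _; rewrite -[X in measurable X]setTI.
  have mt w' : measurable_fun setT (fun w => tnth (param S w' w) j).
    by apply: (measurableT_comp (measurable_tnth j) (mp w')).
  by apply: (measurable_funB (mt u) (mt v)) => //; exact: measurable_itv.
split=> //.
apply: (@indep_close_le _ _ _ (Pr S) _ (param S u) (param S v)) => //.
- by have /andP[/le_trans h /h] := f_bound (param S u point).
(* Pairwise independence is read off the joint product formula, every other factor being 1. *)
- move=> C D mC mD; pose B t := if t == u then C else if t == v then D else setT.
  have mB t : measurable (B t) by rewrite /B; case: ifP => // _; case: ifP.
  have := indep B mB.
  rewrite (bigD1 u)//= (bigD1 v) ?[v == u]eq_sym//= big1 => [|t].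
    rewrite mule1 /B eqxx eq_sym (negPf uv) eqxx => <-; congr (Pr S _).
    apply/seteqP; split=> w.
      by move=> [Cw Dw] t; case: eqP => [->//|_]; case: eqP => [->//|].
    by move=> h; split; [have := h u|have := h v]; rewrite ?eqxx// eq_sym (negPf uv).
  by move=> /andP[/negPf tu /negPf tv]; rewrite /B tu tv preimage_setT probability_setT.
- exact: param_prob_le.
- move=> w j [[p01 _] h]; split; last exact: h.
  by have /andP[/ltW-> /ltW] := p01 j.
Qed.

(** The conclusion is about the integral of [f], which does not mention the system: a [tau] found in
    one system serves every number of users. The proof uses a system because continuity from below
    is applied to the law of [param S u]. *)
Lemma inner_region_prob (u : 'I_n) (eta : R) : 0 < eta -> exists2 tau : R, 0 < tau <= 1 &
  (\int[@lebesgue_tuple R d]_(x in ~` @inner_region R d tau) (f x)%:E <= eta%:E)%E.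
Proof.
move=> eta0; have [[_ [law _] _] _] := modS.
apply: contrapT => h.
pose F k := param S u @^-1` @inner_region R d k.+1%:R^-1.
have mF k : measurable (F k).
  by apply: measurable_param => //; exact: measurable_inner_region.
have UF : \bigcup_k F k = param S u @^-1` param_region R d.
  by rewrite -preimage_bigcup bigcup_inner_region.
have mUF : measurable (\bigcup_k F k) by exact: bigcupT_measurable.
have PUF : Pr S (\bigcup_k F k) = 1%E.
  have := probability_setC (Pr S) (measurableC mUF); rewrite setCK => ->.
  by rewrite UF preimage_setC param_out_region sube0.
have ndF : nondecreasing_seq F.
  move=> i j ij; apply/subsetPset => w [h1 h2].
  have le_ij : j.+1%:R^-1 <= i.+1%:R^-1 :> R.
    by rewrite lef_pV2 ?posrE// ler_nat.
  split=> [l|]; first exact: le_trans (h1 l).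
  by apply: le_trans h2 _; rewrite lerD2l lerN2.
have cF : (fun k => Pr S (F k)) @ \oo --> Pr S (\bigcup_k F k).
  exact: nondecreasing_cvg_mu.
have : (Pr S (\bigcup_k F k) <= (1 - eta)%:E)%E.
  apply: (cvge_to_le cF); apply: nearW => k /=.
  rewrite leNgt; apply/negP => hk; apply: h; exists k.+1%:R^-1.
    by rewrite invr_gt0 ltr0n/= invf_le1 ?ltr0n// ler1n.
  rewrite -(law u); last by apply: measurableC; exact: measurable_inner_region.
  have PFC : Pr S (param S u @^-1` ~` inner_region k.+1%:R^-1) =
      (1 - Pr S (F k))%E.
    by rewrite -preimage_setC; exact: (probability_setC (Pr S) (mF k)).
  have PFk : Pr S (F k) = (fine (Pr S (F k)))%:E.
    by rewrite fineK// fin_num_measure.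
  by rewrite PFC; move: hk; rewrite PFk -EFinB lte_fin lee_fin; lra.
by rewrite PUF lee_fin; lra.
Qed.

End model.

(** * The estimator *)

Section estimation.
Context (R : realType) (r d n : nat) (S : system R r d n).
Hypothesis mS : measurable_system S.

Lemma measurable_param_profile : measurable_fun setT (@param_profile R r d n S).
Proof.
apply/measurable_fun_tnthP => u; have [mp _ _ _ _] := mS.
rewrite (_ : _ \o _ = param S u)//; apply/funext => w /=.
by rewrite tnth_mktuple.
Qed.

Lemma measurable_observation m y : measurable (@observation R r d n S m @^-1` [set y]).
Proof.
have [_ _ _ mr ma] := mS.
apply: (measurable_by_label (L := anon S) (B := fun s => \bigcap_(kv in [set: 'I_m * 'I_n])
  report S ((s^-1)%g kv.2) kv.1 @^-1` [set y kv.1 kv.2])) => //.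
  by move=> s; apply: fin_bigcap_measurable => // kv _; exact: mr.
move=> w; split=> [/= <- kv _ /=|h]; first by rewrite mxE.
by apply/matrixP => k v; rewrite mxE; exact: (h (k, v)).
Qed.

Lemma measurable_error m (g : 'M['I_r]_(m, n) -> n.-tuple (d.-tuple R) -> 'I_r) u k :
  estimator g ->
  measurable [set w | g (observation m w) (param_profile w) <> data S u k w].
Proof.
move=> mg; have [_ md _ _ _] := mS.
apply: (measurable_by_label (L := fun w => (observation m w, data S u k w))
  (B := fun yi => ~` (@param_profile R r d n S @^-1` (g yi.1 @^-1` [set yi.2])))) => //.
- move=> [y i]; rewrite (_ : _ @^-1` _ = @observation R r d n S m @^-1` [set y] `&`
      data S u k @^-1` [set i]); last first.
    by apply/seteqP; split=> w /=; [case=> <- <-|case=> <- <-].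
  by apply: measurableI => //; exact: measurable_observation.
- move=> [y i]; apply: measurableC; rewrite -[X in measurable X]setTI.
  by apply: measurable_param_profile => //; exact: mg.
Qed.

End estimation.

Section matching.
Context (R : realType) (r d : nat) (i0 : 'I_r).
Context (last : 'I_r -> 'I_r) (free : 'I_d -> 'I_r * 'I_r).
Local Notation Q := (@transition_matrix R r d last free).

Definition column n m (y : 'M['I_r]_(m, n)) v : nat -> 'I_r :=
  nth i0 [tuple y k v | k < m].

(** [m] observed letters contain [m.-1] transitions. *)
Definition matches n m (thr : R) (y : 'M['I_r]_(m, n)) v (p : d.-tuple R) :=
  [forall i, forall l, `|drift (Q p) m.-1 (column y v) i l| <= thr].

Definition matching n m (thr : R) k (y : 'M['I_r]_(m, n.+1))
    (pp : n.+1.-tuple (d.-tuple R)) : 'I_r :=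
  if [pick v | matches thr y v (tnth pp ord0)] is Some v then column y v k else i0.

Lemma measurable_matches n m thr (y : 'M['I_r]_(m, n)) v :
  measurable [set p | matches thr y v p].
Proof.
have -> : [set p | matches thr y v p] = \bigcap_(il in [set: 'I_r * 'I_r])
    (fun p => `|drift (Q p) m.-1 (column y v) il.1 il.2|) @^-1` `]-oo, thr]%classic.
  apply/seteqP; split=> p /=.
    by move=> /forallP h [i l] _; rewrite /= in_itv/=; have /forallP := h i.
  move=> h; apply/forallP => i; apply/forallP => l.
  by have := h (i, l) I; rewrite /= in_itv.
apply: fin_bigcap_measurable => // il _; rewrite -[X in measurable X]setTI.
have : measurable_fun setT (fun p => `|drift (Q p) m.-1 (column y v) il.1 il.2|).
  apply: measurableT_comp => //; exact: measurable_drift.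
by apply.
Qed.

(** For a fixed observation the value depends on the profile only through the set of accepted
    columns, which serves as a finite label. *)
Lemma estimator_matching n m thr k : estimator (@matching n m thr k).
Proof.
move=> y i.
pose T v := [set pp : n.+1.-tuple (d.-tuple R) | matches thr y v (tnth pp ord0)].
have mT v : measurable (T v).
  exact: (measurable_preimage (Z := fun pp : n.+1.-tuple (d.-tuple R) => tnth pp ord0)
    (measurable_tnth ord0) (measurable_matches thr y v)).
pose L (pp : n.+1.-tuple (d.-tuple R)) := [set v | matches thr y v (tnth pp ord0)]%SET.
pose G (V : {set 'I_n.+1}) := if [pick v in V] is Some v then column y v k else i0.
apply: (measurable_by_label (L := L) (B := fun V => [set _ | G V = i])).
- move=> V; rewrite (_ : _ @^-1` _ =
      \bigcap_(v in [set: 'I_n.+1]) (if v \in V then T v else ~` T v)).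
    apply: fin_bigcap_measurable => // v _; case: ifP => _ //; exact: measurableC.
  apply/seteqP; split=> pp /=.
    by move=> <- v _; rewrite inE; case: ifP => // /negbT /negP.
  move=> h; apply/setP => v; rewrite inE; have := h v I.
  by case: ifP => _ //= /negP/negPf.
- by move=> V; have [e|e] := pselect (G V = i);
    [rewrite (_ : [set _ | _] = setT)|rewrite (_ : [set _ | _] = set0)] => //;
    apply/seteqP; split.
- move=> pp /=; rewrite /matching /G.
  by rewrite (@eq_pick _ _ [pred v in L pp])// => v; rewrite /= inE.
Qed.

End matching.

(** * The error bound *)

Section union_bound.
Context (R : realType) disp (Om : measurableType disp) (P : probability Om R).
Implicit Types (A B : set Om) (b : R).

Definition event_le A b := measurable A /\ (P A <= b%:E)%E.

Lemma event_leU A B b b' : event_le A b -> event_le B b' ->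
  event_le (A `|` B) (b + b').
Proof.
move=> [mA Ab] [mB Bb]; split; first exact: measurableU.
have le_U : (P (A `|` B) <= P A + P B)%E by exact: measureU2.
by apply: le_trans le_U _; rewrite EFinD leeD.
Qed.

Lemma event_le_bigcup (I : finType) (A : I -> set Om) b :
  (forall i, event_le (A i) b) ->
  event_le (\bigcup_(i in [set: I]) A i) (#|I|%:R * b).
Proof.
move=> Ab; have mA i : measurable (A i) by have [] := Ab i.
split; first exact: fin_bigcup_measurable.
have -> : \bigcup_(i in [set: I]) A i = \big[setU/set0]_i A i.
  rewrite -bigcup_seq; apply/seteqP.
  by split=> w [i _ ?]; exists i => //=; rewrite mem_index_enum.
have le_U : (P (\big[setU/set0]_i A i) <= \sum_i P (A i))%E.
  exact: measure_bigsetU_le.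
apply: le_trans le_U _.
apply: (@le_trans _ _ (\sum_(i : I) b%:E)%E).
  by apply: lee_sum => i _; have [] := Ab i.
by rewrite sumEFin sumr_const mulr_natl.
Qed.

End union_bound.

Section error_bound.
Context (R : realType) (r d n : nat) (S : system R r d n.+1) (i0 : 'I_r).
Context (E : {set 'I_r * 'I_r}) (last : 'I_r -> 'I_r) (free : 'I_d -> 'I_r * 'I_r).
Context (f : d.-tuple R -> R) (a delta2 : R).
Local Notation Q := (@transition_matrix R r d last free).
Hypothesis graphE : irreducible_aperiodic_graph R E.
Hypothesis Efree : free_edges E last free.
Hypothesis r2 : (2 <= r)%N.
Hypothesis f_out : forall p, ~ param_region R d p -> f p = 0.
Hypothesis f_bound : forall p, 0 <= f p <= delta2.
Hypothesis a01 : 0 < a <= 1.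
Hypothesis modS : obfuscated_model S f Q a.
Context (M k : nat) (tau h : R).
Hypothesis kM : (k <= M)%N.
Hypothesis tau01 : 0 < tau <= 1.
Hypothesis h01 : 0 < h <= 1.
Let m := M.+1.
Let kappa := tau ^+ r / r%:R.
Hypothesis rh : r%:R * h <= kappa / 4.
Hypothesis mlarge : kappa + r%:R <= kappa * m%:R / 4.
Let thr := m%:R * h.
Let eps := 4 * h / kappa.
Let mS : measurable_system S. Proof. by have [[]] := modS. Qed.

Let r0 : 0 < r%:R :> R. Proof. by rewrite ltr0n ltnW. Qed.
Let kappa0 : 0 < kappa.
Proof. by have /andP[tau0 _] := tau01; rewrite divr_gt0// exprn_gt0. Qed.

(* Every state is visited at least kappa m / 2 times, and eps kappa m / 2 = 2 thr. *)
Lemma close_of_drift (p p' : d.-tuple R) (x : nat -> 'I_r) :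
  inner_region tau p ->
  (forall i l, `|drift (Q p) M x i l| <= thr) ->
  (forall i l, `|drift (Q p') M x i l| <= thr) ->
  forall j, `|tnth p' j - tnth p j| <= eps.
Proof.
move=> ptau dp dp' j; have /andP[tau0 tau1] := tau01; have /andP[h0 h1] := h01.
have thr0 : 0 <= thr by rewrite mulr_ge0// ltW.
have tau01' : 0 <= tau <= 1 by rewrite ltW.
have visx := visits_ge (free j).1 (ltnW r2) tau01' thr0
  (graph_connected Efree graphE (inner_region_sub tau0 ptau))
  (fun i l => transition_matrix_ge Efree (ltW tau0) ptau) dp.
(* The bound at hand is [kappa (m - 1) - r (thr + 1)]. By [rh] the part [r thr] costs a quarter of
   [kappa m], and by [mlarge] the constants [kappa + r] cost another quarter. *)
have {}visx : kappa * m%:R / 2 <= (visits M x (free j).1)%:R.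
  apply: le_trans visx.
  rewrite -/kappa; have -> : M%:R = m%:R - 1 :> R by rewrite /m -natr1 addrK.
  have gen (u y z t : R) : z * t <= u / 4 -> u + z <= u * y / 4 -> 0 <= y ->
      u * y / 2 <= u * (y - 1) - z * (y * t + 1).
    by move=> zt xz y0; have := ler_wpM2l y0 zt; lra.
  exact: gen.
have km0 : 0 < kappa * m%:R / 2 by rewrite divr_gt0// mulr_gt0// ltr0n.
have := drift_separates (dp (free j).1 (free j).2) (dp' (free j).1 (free j).2).
rewrite !(transition_matrix_free Efree) => sep.
have : `|tnth p' j - tnth p j| * (kappa * m%:R / 2) <= 2 * thr.
  by apply: le_trans sep; rewrite ler_wpM2l.
rewrite -ler_pdivlMr// => /le_trans; apply.
rewrite /eps /thr le_eqVlt; apply/orP; left; apply/eqP.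
by field; rewrite gt_eqF//= pnatr_eq0.
Qed.

(** The thresholds share out [thr]: a drift of [thr / 2] and [thr / 6] mismatches give the reports a
    drift of at most [thr / 2 + 3 thr / 6] by [drift_mismatches]. *)
Let bad_drift (ul : 'I_n.+1 * ('I_r * 'I_r)) : set (outcome S) :=
  [set w | thr / 2 < `|drift (Q (param S ul.1 w)) M (fun k => data S ul.1 k w) ul.2.1 ul.2.2|].
Let bad_mismatch (u : 'I_n.+1) : set (outcome S) :=
  [set w | thr / 6 < (mismatches m (fun k => data S u k w) (fun k => report S u k w))%:R].
Let bad_close (u : 'I_n.+1) : set (outcome S) :=
  if u == ord0 then set0 else
  [set w | param_region R d (param S ord0 w) /\
     forall j, `|tnth (param S u w) j - tnth (param S ord0 w) j| <= eps].

Lemma column_observation (w : outcome S) v j : (j < m)%N ->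
  column i0 (observation m w) v j = report S ((anon S w)^-1%g v) j w.
Proof.
by move=> jm; rewrite /column -[j]/(val (Ordinal jm)) nth_mktuple mxE.
Qed.

Lemma matching_correct (w : outcome S) :
  inner_region tau (param S ord0 w) ->
  (forall u, param_region R d (param S u w)) ->
  (forall ul, ~ bad_drift ul w) -> (forall u, ~ bad_mismatch u w) ->
  (forall u, ~ bad_close u w) -> report S ord0 k w = data S ord0 k w ->
  matching i0 last free thr k (observation m w) (param_profile w) = data S ord0 k w.
Proof.
move=> ptau reg gdrift gmis gclose zk.
(* Needed for every user: a column of user [u] accepted for user 1 is compared with the matrix of
   [u] itself. *)
have own u i l : `|drift (Q (param S u w)) M (fun k => report S u k w) i l| <= thr.
  have := drift_mismatches M (fun k => data S u k w) (fun k => report S u k w)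
    (stochastic_le1 (stochastic_transition_matrix Efree (reg u)) i l).
  have /negP := gdrift (u, (i, l)); rewrite -leNgt/=.
  have /negP := gmis u; rewrite -leNgt/= -/m.
  by set X := `|drift _ _ _ _ _|; set Y := `|drift _ _ _ _ _|; lra.
have colE v p i l : drift (Q p) M (column i0 (observation m w) v) i l =
    drift (Q p) M (fun k => report S ((anon S w)^-1%g v) k w) i l.
  by apply: eq_drift => j jM; rewrite column_observation.
rewrite /matching tnth_mktuple; case: pickP => [v /forallP mv|nomatch].
  have dv i l : `|drift (Q (param S ord0 w)) M
      (fun k => report S ((anon S w)^-1%g v) k w) i l| <= thr.
    by have /forallP /(_ l) := mv i; rewrite colE.
  have close := close_of_drift ptau dv (own _).
  have v0 : (anon S w)^-1%g v = ord0.
    apply/eqP; apply: contrapT => /negP/negPf v0.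
    apply: (gclose ((anon S w)^-1%g v)); rewrite /bad_close v0; split=> //.
  by rewrite column_observation// v0 zk.
(* Some column is accepted, since the reports of user 1 stand in column [anon S w ord0]. *)
have := nomatch (anon S w ord0); move/negP; case.
apply/forallP => i; apply/forallP => l; rewrite colE permK; exact: own.
Qed.

(** A union bound: [eta] is paid once, for user 1 near the boundary; the bracket is paid for each
    user; the last [a] is the chance that the letter at time [k] was altered. *)
Lemma min_error_le eta :
  (Pr S (param S ord0 @^-1` ~` inner_region tau) <= eta%:E)%E ->
  (min_error S m ord0 k <=
    (eta + n.+1%:R * (2 * (r * r)%:R * expR (- (h ^+ 2 * m%:R / 32)) +
                     expR (a * m%:R - m%:R * h / 12) +
                     delta2 * (12 * h / kappa) ^+ d) + a)%:E)%E.
Proof.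
move=> Peta; have /andP[h0 h1] := h01; have /andP[a0 a1] := a01.
have eps0 : 0 < eps by rewrite divr_gt0// mulr_gt0.
have delta0 : 0 <= delta2 by have /andP[/le_trans g /g] := f_bound (param S ord0 point).
pose Err := [set w : outcome S | matching i0 last free thr k (observation m w)
   (param_profile w) <> data S ord0 k w].
have mE : measurable Err by apply: measurable_error => //; exact: estimator_matching.
apply: (@le_trans _ _ (Pr S Err)).
  apply: ereal_inf_lbound; exists (@matching R r d i0 last free n m thr k) => //.
  exact: estimator_matching.
have e_in : event_le (Pr S) (param S ord0 @^-1` ~` inner_region tau) eta.
  split=> //; apply: measurable_param => //; apply: measurableC.
  exact: measurable_inner_region.
have e_reg : event_le (Pr S)
    (~` \bigcap_(u in [set: 'I_n.+1]) param S u @^-1` param_region R d) 0.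
  split; last by rewrite (params_in_region f_out modS).
  apply: measurableC; apply: fin_bigcap_measurable => // u _.
  by apply: measurable_param => //; exact: measurable_param_region.
have e_drift ul : event_le (Pr S) (bad_drift ul) (2 * expR (- (h ^+ 2 * m%:R / 32))).
  (* [lam = h / 8] minimises [2 lam^2 m - lam m h / 2], with value [- h^2 m / 32]. *)
  have lam12 : 0 <= h / 8 <= 1 / 2 by apply/andP; split; lra.
  have [mA PA] := drift_prob i0 Efree f_out modS ul.1 ul.2.1 ul.2.2 (thr / 2) M lam12.
  split=> //; apply: le_trans PA _; rewrite lee_fin ler_wpM2l// ler_expR.
  have -> : M%:R = m%:R - 1 :> R by rewrite /m -natr1 addrK.
  by have := sqr_ge0 h; rewrite /thr !expr2; nra.
have e_mis u : event_le (Pr S) (bad_mismatch u) (expR (a * m%:R - m%:R * h / 12)).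
  have [mA PA] := mismatch_prob i0 r2 a01 modS u m (thr / 6).
  split=> //; apply: le_trans PA _; rewrite lee_fin ler_expR /thr; lra.
have e_close u : event_le (Pr S) (bad_close u) (delta2 * (12 * h / kappa) ^+ d).
  rewrite /bad_close; case: (eqVneq u ord0) => [_|u0].
    split; rewrite ?measure0 ?lee_fin// mulr_ge0// exprn_ge0// divr_ge0 ?ltW//.
    by rewrite mulr_gt0.
  have [mA PA] := params_close_le f_bound modS u0 eps0.
  split=> //; apply: le_trans PA _; rewrite lee_fin ler_wpM2l//.
  by rewrite (_ : 3 * eps = 12 * h / kappa)// /eps; ring.
have e_flip := flip_event i0 r2 a01 modS ord0 k.
have [mU PU] := event_leU (event_leU (event_leU (event_leU (event_leU
  e_in e_reg) (event_le_bigcup e_drift)) (event_le_bigcup e_mis))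
  (event_le_bigcup e_close)) e_flip.
apply: (@le_trans _ _ (Pr S _)); last first.
  apply: le_trans PU _; rewrite lee_fin !card_prod !card_ord.
  by rewrite natrM le_eqVlt; apply/orP; left; apply/eqP; ring.
apply: le_measure; rewrite ?inE// => w errw.
apply: contrapT => /not_orP[/not_orP[/not_orP[/not_orP[/not_orP[g1 g2] g3] g4] g5] g6].
apply: errw; apply: matching_correct.
- exact: (contrapT g1).
- by move=> u; exact: (contrapT g2 u I).
- by move=> ul b; apply: g3; exists ul.
- by move=> u b; apply: g4; exists u.
- by move=> u b; apply: g5; exists u.
- exact: (contrapT g6).
Qed.

End error_bound.

(** * Asymptotics *)

Section asymptotics.
Context (R : realType).
Implicit Types (p B alpha beta c v w s : R).

Lemma powR_large p B : 0 < p -> \forall n \near \oo, B <= n.+1%:R `^ p.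
Proof.
move=> p0; near=> n; pose B' := Num.max B 1.
have B1 : 1 <= B' by rewrite le_max lexx orbT.
have B0 : 0 <= B' by rewrite (le_trans ler01).
apply: (@le_trans _ _ B'); first by rewrite le_max lexx.
have {1}-> : B' = (B' `^ p^-1) `^ p by rewrite -powRrM mulVf ?gt_eqF// powRr1.
apply: ge0_ler_powR; [exact: ltW|by rewrite nnegrE powR_ge0|by rewrite nnegrE|].
apply: (@le_trans _ _ n%:R); last by rewrite ler_nat.
by near: n; exact: nbhs_infty_ger.
Unshelve. all: by end_near. Qed.

(** The factor [s] is absorbed because [ln s = (4 / alpha) ln v] is at most linear in [v], while [w]
    is at least quadratic; hence [ln s - w <= - v], and [exp(- v) <= 1 / v]. *)
Lemma mul_expRN_le s v w alpha c : 0 < s -> 0 < alpha -> v = s `^ (alpha / 4) ->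
  1 <= v -> 4 / alpha + 2 <= c * v / 32 -> (c * v ^+ 2 - 1) / 32 <= w ->
  s * expR (- w) <= v^-1.
Proof.
move=> s0 alpha0 vE v1 cv wv; have v0 : 0 < v by lra.
have lnv : ln v = alpha / 4 * ln s by rewrite vE ln_powR.
have ln_le : ln s <= 4 / alpha * v.
  have -> : ln s = 4 / alpha * ln v by rewrite lnv; field; rewrite gt_eqF.
  by rewrite ler_wpM2l ?divr_ge0// ?ltW// ln_sublinear.
rewrite -{1}(lnK s0) -expRD; apply: (@le_trans _ _ (expR (- v))).
  rewrite ler_expR; have := ler_wpM2r (ltW v0) cv; rewrite !expr2 in wv *; nra.
rewrite expRN lef_pV2 ?posrE ?expR_gt0//.
by apply: le_trans (expR_ge1Dx _); lra.
Qed.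

(** Here [s] is the number of users, [q = s^(1/d)], [v = s^(alpha/4)] and [g = s^(beta - alpha/4)].
    In these variables real powers disappear: [m] is about [c q^2 v^4], [s h^d = v^(-d)] and
    [a / h = c' / g], and each error term is at most a constant over [v]. *)
Lemma bound_of_large (d r k m : nat) (s v q g alpha c c' delta kappa eta : R)
    (h := (q * v)^-1) (a := c' / (q * v * g)) :
  (1 <= d)%N -> 0 < alpha -> 0 < c -> 0 < c' -> 0 <= delta -> 0 < kappa ->
  0 < eta -> 0 < s -> v = s `^ (alpha / 4) -> q ^+ d = s ->
  1 <= q -> 1 <= v -> 1 <= g ->
  4 * r%:R / kappa <= v -> (4 * (kappa + r%:R) / kappa + 1) / c <= v ->
  (k%:R + 2) / c <= v -> c' <= v -> 32 * (4 / alpha + 2) / c <= v ->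
  (2 * (r * r)%:R + 1 + delta * (12 / kappa) ^+ d + c') / eta <= v ->
  24 * c' <= g -> c * (q ^+ 2 * v ^+ 4) - 1 < m%:R ->
  [/\ 0 < h <= 1, 0 < a <= 1, (k < m)%N, r%:R * h <= kappa / 4 &
      kappa + r%:R <= kappa * m%:R / 4 /\
      s * (2 * (r * r)%:R * expR (- (h ^+ 2 * m%:R / 32)) +
           expR (a * m%:R - m%:R * h / 12) +
           delta * (12 * h / kappa) ^+ d) + a <= eta].
Proof.
move=> d1 alpha0 c0 c'0 delta0 kappa0 eta0 s0 vE qd q1 v1 g1 v2 v3 v4 v5 v6 v7 g2 mE.
have v0 : 0 < v by lra.
have q0 : 0 < q by lra.
have g0 : 0 < g by lra.
have qv1 : 1 <= q * v by rewrite -[1]mulr1 ler_pM.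
have qv0 : 0 < q * v by rewrite mulr_gt0.
have h0 : 0 < h by rewrite invr_gt0.
have hv : h <= v^-1.
  by rewrite lef_pV2 ?posrE// -[leLHS]mul1r ler_wpM2r// ltW.
have h1 : h <= 1 by rewrite invf_le1.
have aE : a = h * (c' / g) by rewrite /a /h invfM; ring.
have cg : c' / g <= 1 / 24 by rewrite ler_pdivrMr//; lra.
have cg0 : 0 < c' / g by rewrite divr_gt0.
have a0 : 0 < a by rewrite aE mulr_gt0.
have av : a <= c' / v.
  rewrite aE mulrC; apply: ler_pM => //; [exact: ltW|exact: ltW|].
  by rewrite ler_pdivrMr// -[leLHS]mulr1 ler_wpM2l// ltW.
have a1 : a <= 1 by apply: le_trans av _; rewrite ler_pdivrMr// mul1r.
have m0 : 0 <= m%:R :> R by [].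
have cvm : c * v - 1 <= m%:R.
  have : v <= q ^+ 2 * v ^+ 4.
    rewrite -[leLHS]mul1r; apply: ler_pM => //; first by rewrite ltW.
      by rewrite exprn_ege1.
    by rewrite -{1}[v]expr1 ler_weXn2l.
  by move=> /(ler_wpM2l (ltW c0)); lra.
rewrite !ler_pdivrMr// in v3 v4 v6 v7.
rewrite ler_pdivrMr// in v2.
have km : (k < m)%N by rewrite -(ltr_nat R); lra.
have w1 : (c * v ^+ 2 - 1) / 32 <= h ^+ 2 * m%:R / 32.
  rewrite ler_pM2r ?invr_gt0// /h exprVn [_^-1 * _]mulrC ler_pdivlMr ?exprn_gt0//.
  apply: le_trans (ltW mE).
  have : 1 <= (q * v) ^+ 2 by rewrite exprn_ege1.
  have -> : q ^+ 2 * v ^+ 4 = v ^+ 2 * (q * v) ^+ 2 by ring.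
  by set X := (q * v) ^+ 2; lra.
have cv32 : 4 / alpha + 2 <= c * v / 32 by rewrite ler_pdivlMr//; lra.
have E1 : s * expR (- (h ^+ 2 * m%:R / 32)) <= v^-1.
  exact: (mul_expRN_le s0 alpha0 vE v1 cv32 w1).
(* As [24 c' <= g], the noise uses at most half of [m h / 12]; the remaining [m h / 24] exceeds
   [m h^2 / 32], so the estimate behind [E1] applies again. *)
have E2 : s * expR (a * m%:R - m%:R * h / 12) <= v^-1.
  rewrite -[_ - _]opprK; apply: (mul_expRN_le s0 alpha0 vE v1 cv32).
  apply: le_trans w1 _; rewrite aE opprB.
  have mh0 : 0 <= m%:R * h by rewrite mulr_ge0// ltW.
  have := ler_wpM2l mh0 cg; have := ler_wpM2l mh0 h1; rewrite expr2.
  have -> : h * (c' / g) * m%:R = m%:R * h * (c' / g) by ring.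
  have -> : h * h * m%:R = m%:R * h * h by ring.
  by lra.
have E3 : s * (delta * (12 * h / kappa) ^+ d) <= delta * (12 / kappa) ^+ d * v^-1.
  have -> : 12 * h / kappa = 12 / kappa * h by ring.
  rewrite [(_ * h) ^+ d]exprMn /h exprVn [(q * v) ^+ d]exprMn qd invfM.
  have -> : s * (delta * ((12 / kappa) ^+ d * (s^-1 * (v ^+ d)^-1))) =
      delta * (12 / kappa) ^+ d * (v ^+ d)^-1 by field; rewrite !gt_eqF// exprn_gt0.
  apply: ler_wpM2l.
    by rewrite mulr_ge0// exprn_ge0// divr_ge0// ltW.
  rewrite lef_pV2 ?posrE ?exprn_gt0//.
  by rewrite -{1}[v]expr1 ler_weXn2l.
split=> //; [by rewrite h0|by rewrite a0| |split].
- apply: (@le_trans _ _ (r%:R * v^-1)); first by rewrite ler_wpM2l.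
  by rewrite ler_pdivrMr//; lra.
- have : (4 * (kappa + r%:R) / kappa + 1) - 1 <= m%:R by lra.
  by rewrite addrK ler_pdivrMr//; lra.
- apply: (@le_trans _ _ ((2 * (r * r)%:R + 1 + delta * (12 / kappa) ^+ d + c') / v)).
    have comb (A e1 e2 Y Z : R) : 0 <= A -> s * e1 <= v^-1 -> s * e2 <= v^-1 ->
        s * Y <= Z * v^-1 -> s * (A * e1 + e2 + Y) + a <= (A + 1 + Z + c') / v.
      by move=> A0 /(ler_wpM2l A0) + h2 h3; move: av; lra.
    exact: comb.
  by rewrite ler_pdivrMr//; lra.
Qed.

Lemma asymptotic_bound (d r k : nat) (alpha beta c c' delta kappa eta : R) :
  (1 <= d)%N -> 0 < alpha -> alpha / 4 < beta -> 0 < c -> 0 < c' ->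
  0 <= delta -> 0 < kappa -> 0 < eta ->
  \forall n \near \oo, forall (m : nat) (h a : R),
  h = n.+1%:R `^ (- (1 / d%:R + alpha / 4)) ->
  a = c' * n.+1%:R `^ (- (1 / d%:R + beta)) ->
  `|m%:R - c * n.+1%:R `^ (2 / d%:R + alpha)| < 1 ->
  [/\ 0 < h <= 1, 0 < a <= 1, (k < m)%N, r%:R * h <= kappa / 4 &
      kappa + r%:R <= kappa * m%:R / 4 /\
      n.+1%:R * (2 * (r * r)%:R * expR (- (h ^+ 2 * m%:R / 32)) +
           expR (a * m%:R - m%:R * h / 12) +
           delta * (12 * h / kappa) ^+ d) + a <= eta].
Proof.
move=> d1 alpha0 betaH c0 c'0 delta0 kappa0 eta0.
have alpha40 : 0 < alpha / 4 by rewrite divr_gt0.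
have beta0 : 0 < beta - alpha / 4 by rewrite subr_gt0.
have d0 : 0 < d%:R :> R by rewrite ltr0n.
have nv B := powR_large B alpha40.
have ng B := powR_large B beta0.
near=> n.
have v1 : 1
    <= n.+1%:R `^ (alpha / 4) by near: n; exact: nv.
have v2 : 4 * r%:R / kappa
    <= n.+1%:R `^ (alpha / 4) by near: n; exact: nv.
have v3 : (4 * (kappa + r%:R) / kappa + 1) / c
    <= n.+1%:R `^ (alpha / 4) by near: n; exact: nv.
have v4 : (k%:R + 2) / c
    <= n.+1%:R `^ (alpha / 4) by near: n; exact: nv.
have v5 : c'
    <= n.+1%:R `^ (alpha / 4) by near: n; exact: nv.
have v6 : 32 * (4 / alpha + 2) / c
    <= n.+1%:R `^ (alpha / 4) by near: n; exact: nv.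
have v7 : (2 * (r * r)%:R + 1 + delta * (12 / kappa) ^+ d + c') / eta
    <= n.+1%:R `^ (alpha / 4) by near: n; exact: nv.
have g1 : 1
    <= n.+1%:R `^ (beta - alpha / 4) by near: n; exact: ng.
have g2 : 24 * c'
    <= n.+1%:R `^ (beta - alpha / 4) by near: n; exact: ng.
move=> m h a hE aE mE.
set s : R := n.+1%:R in hE aE mE v1 v2 v3 v4 v5 v6 v7 g1 g2 *.
have s0 : 0 < s by rewrite ltr0n.
pose q := s `^ (1 / d%:R).
set v := s `^ (alpha / 4) in v1 v2 v3 v4 v5 v6 v7.
set g := s `^ (beta - alpha / 4) in g1 g2.
have q1 : 1 <= q.
  rewrite -(powRr0 s); apply: ler_powR; last by rewrite divr_ge0.
  by rewrite /s ler1n.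
have pD x y : s `^ (x + y) = s `^ x * s `^ y.
  by rewrite powRD// (gt_eqF s0) implybT.
have qd : q ^+ d = s.
  by rewrite -powR_mulrn ?powR_ge0// -powRrM mul1r mulVf ?gt_eqF// powRr1// ltW.
have hqv : h = (q * v)^-1 by rewrite hE powRN pD.
have aqv : a = c' / (q * v * g).
  rewrite aE powRN (_ : 1 / d%:R + beta = 1 / d%:R + alpha / 4 + (beta - alpha / 4)).
    by rewrite (pD (1 / d%:R + alpha / 4)) (pD (1 / d%:R)).
  by ring.
have mqv : c * (q ^+ 2 * v ^+ 4) - 1 < m%:R.
  move: mE; rewrite (_ : 2 / d%:R + alpha = (1 / d%:R) * 2%:R + (alpha / 4) * 4%:R).
    rewrite pD (powRrM _ (1 / d%:R)) (powRrM _ (alpha / 4)) !powR_mulrn ?powR_ge0// ltr_norml => /andP[+ _].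
    by rewrite -/q -/v; lra.
  by field; rewrite gt_eqF.
rewrite hqv aqv.
exact: (bound_of_large (alpha := alpha) (c := c)).
Unshelve. all: by end_near. Qed.

End asymptotics.

Lemma cvg0_of_eventually_le (R : realType) (u : nat -> \bar R) :
  (forall n, 0 <= u n)%E ->
  (forall eta : R, 0 < eta -> \forall n \near \oo, (u n <= eta%:E)%E) ->
  u n @[n --> \oo] --> 0%E.
Proof.
move=> u0 ule; apply/fine_cvgP; split.
  have := ule 1 ltr01; apply: filterS => n un.
  by rewrite ge0_fin_numE// (le_lt_trans un)// ltry.
apply/cvgr0Pnorm_le => eta eta0; have := ule _ eta0; apply: filterS => n un /=.
have ufin : u n \is a fin_num by rewrite ge0_fin_numE// (le_lt_trans un)// ltry.
by rewrite ger0_norm ?fine_ge0// -lee_fin fineK.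
Qed.

Theorem theorem5 (R : realType) (r : nat) (E : {set 'I_r * 'I_r})
    (last : 'I_r -> 'I_r) (free : 'I_(#|E| - r) -> 'I_r * 'I_r)
    (f : (#|E| - r).-tuple R -> R) (delta1 delta2 c c' alpha beta : R)
    (m : nat -> nat) (a : nat -> R)
    (S : forall n, system R r (#|E| - r) n.+1) :
  (2 <= r)%N ->
  irreducible_aperiodic_graph R E ->
  free_edges E last free ->
  (1 <= #|E| - r)%N ->
  tuple_continuous_on (param_region R (#|E| - r)) f ->
  0 < delta1 -> 0 < delta2 ->
  (forall p, param_region R (#|E| - r) p -> delta1 < f p < delta2) ->
  (forall p, ~ param_region R (#|E| - r) p -> f p = 0) ->
  0 < c -> 0 < alpha ->
  (forall n, (0 < n)%N ->
    `|(m n)%:R - c * n%:R `^ (2 / (#|E| - r)%:R + alpha)| < 1) ->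
  0 < c' -> alpha / 4 < beta ->
  (forall n, a n = c' * n%:R `^ (- (1 / (#|E| - r)%:R + beta))) ->
  (* the system of index n has n.+1 users, and user 1 is ord0 *)
  (forall n, a n.+1 <= 1 ->
    obfuscated_model (S n) f (transition_matrix last free) (a n.+1)) ->
  forall k, min_error (S n) (m n.+1) ord0 k @[n --> \oo] --> 0%E.
Proof.
move=> r2 graphE Efree d1 _ delta10 delta20 f_in f_out c0 alpha0 mE c'0 betaH aE modS k.
set d := (#|E| - r)%N in free f S Efree d1 f_in f_out mE aE modS *.
have i0 : 'I_r by exact: (Ordinal (ltnW r2)).
have f_bound p : 0 <= f p <= delta2.
  have [/f_in/andP[f1 f2]|/f_out ->] := pselect (param_region R d p).
    by rewrite (ltW (lt_trans delta10 f1)) ltW.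
  by rewrite lexx ltW.
have aE' n : a n.+1 = c' * n.+1%:R `^ (- (1 / d%:R + beta)) by [].
apply: cvg0_of_eventually_le => [n|eta eta0].
  by apply: le_ereal_inf_tmp => _ [g _ <-]; exact: measure_ge0.
(* One half pays for user 1 near the boundary, the other for all terms that vanish with n. *)
have eta20 : 0 < eta / 2 by rewrite divr_gt0.
have delta2_ge0 := ltW delta20.
have bound kappa : 0 < kappa -> _ :=
  fun kappa0 => asymptotic_bound r k d1 alpha0 betaH c0 c'0 delta2_ge0 kappa0 eta20.
(* [kappa] depends on [tau], [tau] comes from a model, and a model is only available once [a] is at
   most 1. A preliminary use of the bound with [kappa = 1] provides such an index. *)
have [N aN1] : exists N, 0 < a N.+1 <= 1.
  have [N _ hN] := bound 1 ltr01; exists N.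
  by have [_ ? _ _ _] := hN N (leqnn N) _ _ _ erefl (aE' N) (mE N.+1 isT).
have [tau tau01 ptau] :=
  inner_region_prob f_out (modS N (andP aN1).2) ord0 eta20.
have /andP[tau0 _] := tau01.
have kappa0 : 0 < tau ^+ r / r%:R by rewrite divr_gt0 ?exprn_gt0// ltr0n ltnW.
have := bound _ kappa0; apply: filterS => n hn.
have [h01 a01 km rh [mlarge le_eta]] := hn _ _ _ erefl (aE' n) (mE n.+1 isT).
(* [k < m] excludes [m = 0] and gives the form [M.+1] that [min_error_le] works with. *)
case: (m n.+1) km mlarge le_eta => // M; rewrite ltnS => kM mlarge le_eta.
have mod := modS n (andP a01).2.
have ptau' : (Pr (S n) (param (S n) ord0 @^-1` ~` inner_region tau) <= (eta / 2)%:E)%E.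
  have [[_ [law _] _] _] := mod; rewrite law//.
  by apply: measurableC; exact: measurable_inner_region.
have le_err :=
  min_error_le i0 graphE Efree r2 f_out f_bound a01 mod kM tau01 h01 rh mlarge ptau'.
apply: (le_trans le_err).
by rewrite lee_fin -addrA; lra.
Qed.
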